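(* Let $\Bbbk$ be a field and $\mathcal C$ a strict $\Bbbk$-linear monoidal category, and let $\mathcal C\text{-Mod}$ be the 2-category of strict $\mathcal C$-module categories, $\mathcal C$-module functors and $\mathcal C$-module transformations. There is a 2-functor $$\mathbb S:\mathcal C\text{-Mod}\to\mathcal C\text{-Tamb}(\mathcal C,\mathcal C)^{\otimes\mathrm{opp}}\text{-}\mathbf{Cat},$$ sending $\mathbf M$ to the enriched category with the objects of $\mathbf M$ and hom-objects $[X,Y]$, $(F,G)\mapsto\mathrm{Hom}_{\mathbf M}(\mathbf MF\,X,\mathbf MG\,Y)$, which is a 2-equivalence onto its essential image.
   Context: All categories, functors, etc. are $\Bbbk$-linear; $FG$ abbreviates $F\otimes G$ in $\mathcal C$. A strict $\mathcal C$-module category is a category $\mathbf M$ with a strict monoidal functor $\mathcal C\to\mathrm{End}(\mathbf M)$, $F\mapsto\mathbf MF$. A $\mathcal C$-module functor $\Phi:\mathbf M\to\mathbf N$ is a functor with coherent natural isomorphisms $\phi_F:\mathbf NF\,\Phi\Rightarrow\Phi\,\mathbf MF$; $\mathcal C$-module transformations are natural transformations compatible with these. $\mathcal C\text{-Tamb}(\mathcal C,\mathcal C)$ is the category of Tambara modules: functors $\mathtt\Phi:\mathcal C^{\mathrm{op}}\otimes_\Bbbk\mathcal C\to\mathbf{Vec}_\Bbbk$ with linear maps $\mathsf t_{H;F,G}:\mathtt\Phi(F,G)\to\mathtt\Phi(HF,HG)$, natural in $F,G$, extranatural in $H$, with $\mathsf t_{KH}=\mathsf t_K\circ\mathsf t_H$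 and $\mathsf t_{\mathbb 1}=\mathrm{id}$; morphisms are natural transformations commuting with the $\mathsf t$'s. It is monoidal under $(\mathtt\Psi\diamond\mathtt\Phi)(F,G)=\int^{H}\mathtt\Psi(F,H)\otimes_\Bbbk\mathtt\Phi(H,G)$ (Tambara structure induced by $\mathsf t^{\mathtt\Psi}\otimes\mathsf t^{\mathtt\Phi}$), with unit $\mathcal C(-,-)$. $\otimes\mathrm{opp}$ denotes reversal of the tensor product, and $\mathcal V\text{-}\mathbf{Cat}$ is the 2-category of $\mathcal V$-enriched categories, functors and natural transformations. Thus composition in a $\mathcal C\text{-Tamb}(\mathcal C,\mathcal C)^{\otimes\mathrm{opp}}$-category $\mathcal M$ is given by Tambara morphisms $\mathcal M(X,Y)\diamond\mathcal M(Y,Z)\to\mathcal M(X,Z)$. For every Tambara module $\mathtt R$, $\mathrm{Hom}(\mathcal C(-,-),\mathtt R)\cong\mathtt R(\mathbb 1,\mathbb 1)$ by evaluation at $\mathrm{id}_{\mathbb 1}$. The 2-functor $\mathbb S$: $\mathbb S(\mathbf M)(X,Y)=[X,Y]$ with Tambara structure $f\mapsto\mathbf MH(f)$, composition $f\otimes g\mapsto g\circ f$ and units $\mathcal C(F,G)\ni f\mapsto(\mathbf Mf)_X$. For a module functor $\Phi$, $\mathbb S(\Phi)$ acts as $\Phi$ on objects and on hom-objects by $f\mapsto\Phi(f)$, under the identifications $\mathbf NF\,\Phi X\cong\Phi\,\mathbf MF\,X$ given by $\phi$. For a module transformation $t:\Phi\Rightarrow\Phi'$, the component $\mathbb S(t)_X$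 is the Tambara morphism $\mathcal C(-,-)\to[\Phi X,\Phi'X]$ corresponding to $t_X\in\mathrm{Hom}_{\mathbf N}(\Phi X,\Phi'X)$. The essential image of $\mathbb S$ is the full sub-2-category on the enriched categories equivalent to some $\mathbb S(\mathbf M)$; being a 2-equivalence onto it means being an equivalence on hom-categories (so that $\mathbb S$ is an equivalence of 2-categories, up to equivalence of objects, onto this sub-2-category). *)

(* Defs.v *)
From HB Require Import structures.
From mathcomp Require Import all_boot all_algebra generic_quotient.
From mathcomp Require Import boolp.

Set Implicit Arguments.
Unset Strict Implicit.
Unset Printing Implicit Defensive.

Import GRing.Theory.
Local Open Scope ring_scope.
Local Open Scope quotient_scope.

Declare Scope lin_scope.
Delimit Scope lin_scope with lin.
Local Open Scope lin_scope.

Reserved Notation "g \c f" (at level 50, left associativity).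
Reserved Notation "g \v f" (at level 50, left associativity).

Section LinearFacts.
Variables (k : fieldType) (U V : lmodType k) (f : U -> V).
Hypothesis f_lin : linear f.

Lemma linfD u v : f (u + v) = f u + f v.
Proof. by have := f_lin 1 u v; rewrite !scale1r. Qed.

Lemma linf0 : f 0 = 0.
Proof. by apply: (addIr (f 0)); rewrite -linfD !add0r. Qed.

Lemma linfZ a u : f (a *: u) = a *: f u.
Proof. by have := f_lin a u 0; rewrite linf0 !addr0. Qed.

End LinearFacts.

Lemma linear_comp (k : fieldType) (U V W : lmodType k) (g : V -> W) (f : U -> V) :
  linear g -> linear f -> linear (fun x => g (f x)).
Proof. by move=> g_lin f_lin a u v; rewrite f_lin g_lin. Qed.

Record LinCat (k : fieldType) : Type := MkLinCat {
  lob :> Type;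
  lhom : lob -> lob -> lmodType k;
  lid : forall X, lhom X X;
  lcomp : forall X Y Z, lhom Y Z -> lhom X Y -> lhom X Z;
  lcompA : forall W X Y Z (h : lhom Y Z) (g : lhom X Y) (f : lhom W X),
    lcomp h (lcomp g f) = lcomp (lcomp h g) f;
  lcomp1l : forall X Y (f : lhom X Y), lcomp (lid Y) f = f;
  lcomp1r : forall X Y (f : lhom X Y), lcomp f (lid X) = f;
  lcomp_linl : forall X Y Z (f : lhom X Y),
    linear (fun g : lhom Y Z => lcomp g f);
  lcomp_linr : forall X Y Z (g : lhom Y Z),
    linear (fun f : lhom X Y => lcomp g f)
}.

Notation "g \c f" := (lcomp g f) : lin_scope.

(* The identity of [X], read as a morphism to an object equal to [X].  The
   strictness equations between morphisms are stated modulo these. *)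
Definition idto (k : fieldType) (C : LinCat k) (X Y : C) (e : X = Y) :
    lhom X Y :=
  match e in _ = Z return lhom X Z with erefl => lid X end.

Section Idto.
Variables (k : fieldType) (C : LinCat k).

Lemma idto1 (X : C) (e : X = X) : idto e = lid X.
Proof. by rewrite (Prop_irrelevance e erefl). Qed.

Lemma idto_irr (X Y : C) (e e' : X = Y) : idto e = idto e'.
Proof. by rewrite (Prop_irrelevance e e'). Qed.

Lemma idto_comp (X Y Z : C) (e : Y = Z) (e' : X = Y) :
  idto e \c idto e' = idto (etrans e' e).
Proof. by case: _ / e; rewrite lcomp1l; apply: idto_irr. Qed.

Lemma idtoK (X Y : C) (e : X = Y) (e' : Y = X) : idto e' \c idto e = lid X.
Proof. by rewrite idto_comp idto1. Qed.

Lemma idtoKl (X Y Z : C) (e : X = Y) (e' : Y = X) (f : lhom Z X) :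
  idto e' \c (idto e \c f) = f.
Proof. by rewrite lcompA idtoK lcomp1l. Qed.

Lemma idtoKr (X Y Z : C) (e : X = Y) (e' : Y = X) (f : lhom X Z) :
  f \c idto e' \c idto e = f.
Proof. by rewrite -lcompA idtoK lcomp1r. Qed.

End Idto.

Record LinFun (k : fieldType) (A B : LinCat k) : Type := MkLinFun {
  fob :> A -> B;
  fmor : forall X Y : A, lhom X Y -> lhom (fob X) (fob Y);
  fmor_lin : forall X Y : A, linear (@fmor X Y);
  fmor_id : forall X, fmor (lid X) = lid (fob X);
  fmor_comp : forall X Y Z (g : lhom Y Z) (f : lhom X Y),
    fmor (g \c f) = fmor g \c fmor f
}.

Section LinFunOps.
Variables (k : fieldType).

Lemma linfun_id_subproof (A : LinCat k) (X Y : A) :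
  linear (fun f : lhom X Y => f).
Proof. by []. Qed.

Definition linfun_id (A : LinCat k) : LinFun A A :=
  @MkLinFun k A A id (fun X Y f => f) (@linfun_id_subproof A)
    (fun X => erefl) (fun X Y Z g f => erefl).

Lemma linfun_comp_lin (A B C : LinCat k) (G : LinFun B C) (F : LinFun A B)
  (X Y : A) : linear (fun f : lhom X Y => fmor G (fmor F f)).
Proof. by move=> a u v; rewrite !fmor_lin. Qed.

Lemma linfun_comp_id (A B C : LinCat k) (G : LinFun B C) (F : LinFun A B)
  (X : A) : fmor G (fmor F (lid X)) = lid (G (F X)).
Proof. by rewrite !fmor_id. Qed.

Lemma linfun_comp_comp (A B C : LinCat k) (G : LinFun B C) (F : LinFun A B)
  (X Y Z : A) (g : lhom Y Z) (f : lhom X Y) :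
  fmor G (fmor F (g \c f)) = fmor G (fmor F g) \c fmor G (fmor F f).
Proof. by rewrite !fmor_comp. Qed.

Definition linfun_comp (A B C : LinCat k) (G : LinFun B C) (F : LinFun A B) :
    LinFun A C :=
  @MkLinFun k A C (fun X => G (F X)) (fun X Y f => fmor G (fmor F f))
    (linfun_comp_lin G F) (linfun_comp_id G F) (linfun_comp_comp G F).

Lemma fmor_idto (A B : LinCat k) (F : LinFun A B) (X Y : A) (e : X = Y)
  (e' : F X = F Y) : fmor F (idto e) = idto e'.
Proof. by case: _ / e e' => e'; rewrite fmor_id idto1. Qed.

Definition fob_eq (A B : LinCat k) (F G : LinFun A B) (e : F = G) (X : A) :
  F X = G X := congr1 (fun T : LinFun A B => T X) e.

Lemma fmor_eq (A B : LinCat k) (F G : LinFun A B) (e : F = G) (X Y : A)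
  (f : lhom X Y) (eX : F X = G X) (eY : F Y = G Y) :
  idto eY \c fmor F f = fmor G f \c idto eX.
Proof. by case: _ / e eX eY => eX eY; rewrite !idto1 lcomp1l lcomp1r. Qed.

Lemma linfun_ext (A B : LinCat k) (o : A -> B)
  (m m' : forall X Y : A, lhom X Y -> lhom (o X) (o Y)) l l' i i' c c' :
  (forall X Y (f : lhom X Y), m X Y f = m' X Y f) ->
  @MkLinFun k A B o m l i c = @MkLinFun k A B o m' l' i' c'.
Proof.
move=> mm'; have e : m = m'.
  do 2![apply: functional_extensionality_dep => ?]; exact: funext.
by case: _ / e l' i' c' => l' i' c'; congr MkLinFun; apply: Prop_irrelevance.
Qed.

End LinFunOps.

Record LinNat (k : fieldType) (A B : LinCat k) (F G : LinFun A B) : Type :=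
  MkLinNat {
  ncomp :> forall X : A, lhom (F X) (G X);
  nnat : forall X Y (f : lhom X Y), ncomp Y \c fmor F f = fmor G f \c ncomp X
}.

Record StrictMonCat (k : fieldType) : Type := MkStrictMonCat {
  smcat :> LinCat k;
  tens : smcat -> smcat -> smcat;
  tensm : forall F F' G G' : smcat,
    lhom F F' -> lhom G G' -> lhom (tens F G) (tens F' G');
  sunit : smcat;
  tensm_linl : forall F F' G G' (g : lhom G G'),
    linear (fun f : lhom F F' => tensm f g);
  tensm_linr : forall F F' G G' (f : lhom F F'),
    linear (fun g : lhom G G' => tensm f g);
  tensm_id : forall F G, tensm (lid F) (lid G) = lid (tens F G);
  tensm_comp : forall F F' F'' G G' G'' (f' : lhom F' F'') (f : lhom F F')
      (g' : lhom G' G'') (g : lhom G G'),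
    tensm (f' \c f) (g' \c g) = tensm f' g' \c tensm f g;
  tensA : forall F G H, tens F (tens G H) = tens (tens F G) H;
  tens1o : forall F, tens sunit F = F;
  tenso1 : forall F, tens F sunit = F;
  tensmA : forall F F' G G' H H' (f : lhom F F') (g : lhom G G')
      (h : lhom H H'),
    idto (tensA F' G' H') \c tensm f (tensm g h)
      = tensm (tensm f g) h \c idto (tensA F G H);
  tens1m : forall F F' (f : lhom F F'),
    idto (tens1o F') \c tensm (lid sunit) f = f \c idto (tens1o F);
  tensm1 : forall F F' (f : lhom F F'),
    idto (tenso1 F') \c tensm f (lid sunit) = f \c idto (tenso1 F)
}.

(* A strict monoidal linear functor [C -> End(M)]: [act F] is the endofunctor
   [MF], and [actm f] is the natural transformation [Mf]. *)
Record ModCat (k : fieldType) (C : StrictMonCat k) : Type := MkModCat {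
  mcat :> LinCat k;
  act : C -> LinFun mcat mcat;
  actm : forall F G : C, lhom F G -> LinNat (act F) (act G);
  actm_lin : forall (F G : C) (X : mcat),
    linear (fun f : lhom F G => actm f X);
  actm_id : forall (F : C) (X : mcat), actm (lid F) X = lid (act F X);
  actm_comp : forall (F G H : C) (g : lhom G H) (f : lhom F G) (X : mcat),
    actm (g \c f) X = actm g X \c actm f X;
  act_one : act (sunit C) = linfun_id mcat;
  act_tens : forall F G : C,
    act (tens F G) = linfun_comp (act F) (act G);
  actm_tens : forall (F F' G G' : C) (f : lhom F F') (g : lhom G G')
      (X : mcat),
    idto (fob_eq (act_tens F' G') X) \c actm (tensm f g) X
      = actm f (act G' X) \c fmor (act F) (actm g X)
          \c idto (fob_eq (act_tens F G) X)
}.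

Section ModCatFacts.
Variables (k : fieldType) (C : StrictMonCat k).

Lemma tensm_idto (F F' G G' : C) (e : F = F') (e' : G = G')
  (e'' : tens F G = tens F' G') : tensm (idto e) (idto e') = idto e''.
Proof. by case: _ / e e''; case: _ / e' => e''; rewrite tensm_id idto1. Qed.

Variable M : ModCat C.

Definition act1E (X : M) : act M (sunit C) X = X := fob_eq (act_one M) X.

Definition actTE (F G : C) (X : M) :
  act M (tens F G) X = act M F (act M G X) := fob_eq (act_tens M F G) X.

Lemma act1_mor (X Y : M) (u : lhom X Y) :
  idto (act1E Y) \c fmor (act M (sunit C)) u = u \c idto (act1E X).
Proof. exact: (fmor_eq (act_one M) u). Qed.

Lemma actT_mor (F G : C) (X Y : M) (u : lhom X Y) :
  idto (actTE F G Y) \c fmor (act M (tens F G)) u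
    = fmor (act M F) (fmor (act M G) u) \c idto (actTE F G X).
Proof. exact: (fmor_eq (act_tens M F G) u). Qed.

Lemma actm_idto (F G : C) (e : F = G) (X : M) (e' : act M F X = act M G X) :
  actm M (idto e) X = idto e'.
Proof. by case: _ / e e' => e'; rewrite actm_id idto1. Qed.

End ModCatFacts.

Record ModFun (k : fieldType) (C : StrictMonCat k) (M N : ModCat C) : Type :=
  MkModFun {
  mfun :> LinFun M N;
  mphi : forall (F : C) (X : M), lhom (act N F (mfun X)) (mfun (act M F X));
  mphiV : forall (F : C) (X : M), lhom (mfun (act M F X)) (act N F (mfun X));
  mphiK : forall F X, mphiV F X \c mphi F X = lid _;
  mphiVK : forall F X, mphi F X \c mphiV F X = lid _;
  mphi_nat : forall F X Y (u : lhom X Y),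
    mphi F Y \c fmor (act N F) (fmor mfun u)
      = fmor mfun (fmor (act M F) u) \c mphi F X;
  mphi_natl : forall F G (f : lhom F G) X,
    mphi G X \c actm N f (mfun X) = fmor mfun (actm M f X) \c mphi F X;
  mphi_one : forall X,
    fmor mfun (idto (act1E X)) \c mphi (sunit C) X = idto (act1E (mfun X));
  mphi_tens : forall F G X,
    fmor mfun (idto (actTE F G X)) \c mphi (tens F G) X
      = mphi F (act M G X) \c fmor (act N F) (mphi G X)
          \c idto (actTE F G (mfun X))
}.

Record ModNat (k : fieldType) (C : StrictMonCat k) (M N : ModCat C)
    (Phi Phi' : ModFun M N) : Type := MkModNat {
  mnat :> LinNat Phi Phi';
  mnat_phi : forall (F : C) (X : M),
    mnat (act M F X) \c mphi Phi F X
      = mphi Phi' F X \c fmor (act N F) (mnat X)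
}.

(* Linear functors on [C^op (x) C] are presented as bilinear functors: [tmap f g]
   is the action of [f (x) g], contravariant in [f]. *)
Record Tamb (k : fieldType) (C : StrictMonCat k) : Type := MkTamb {
  tob :> C -> C -> lmodType k;
  tmap : forall F F' G G' : C,
    lhom F' F -> lhom G G' -> tob F G -> tob F' G';
  tmap_lin : forall F F' G G' (f : lhom F' F) (g : lhom G G'),
    linear (tmap f g);
  tmap_linl : forall F F' G G' (g : lhom G G') (x : tob F G),
    linear (fun f : lhom F' F => tmap f g x);
  tmap_linr : forall F F' G G' (f : lhom F' F) (x : tob F G),
    linear (fun g : lhom G G' => tmap f g x);
  tmap_id : forall F G (x : tob F G), tmap (lid F) (lid G) x = x;
  tmap_comp : forall F F' F'' G G' G'' (f' : lhom F'' F') (f : lhom F' F)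
      (g' : lhom G' G'') (g : lhom G G') (x : tob F G),
    tmap (f \c f') (g' \c g) x = tmap f' g' (tmap f g x);
  tstr : forall H F G : C, tob F G -> tob (tens H F) (tens H G);
  tstr_lin : forall H F G, linear (@tstr H F G);
  tstr_nat : forall H F F' G G' (f : lhom F' F) (g : lhom G G') (x : tob F G),
    tstr H (tmap f g x)
      = tmap (tensm (lid H) f) (tensm (lid H) g) (tstr H x);
  tstr_dinat : forall H K (h : lhom H K) F G (x : tob F G),
    tmap (lid (tens H F)) (tensm h (lid G)) (tstr H x)
      = tmap (tensm h (lid F)) (lid (tens K G)) (tstr K x);
  tstr_one : forall F G (x : tob F G),
    tstr (sunit C) x = tmap (idto (tens1o F)) (idto (esym (tens1o G))) x;
  tstr_tens : forall K H F G (x : tob F G),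
    tstr (tens K H) x
      = tmap (idto (esym (tensA K H F))) (idto (tensA K H G))
          (tstr K (tstr H x))
}.

Record TambMor (k : fieldType) (C : StrictMonCat k) (P Q : Tamb C) : Type :=
  MkTambMor {
  tmor :> forall F G : C, P F G -> Q F G;
  tmor_lin : forall F G : C, linear (@tmor F G);
  tmor_nat : forall F F' G G' (f : lhom F' F) (g : lhom G G') (x : P F G),
    tmor (tmap f g x) = tmap f g (tmor x);
  tmor_str : forall H F G (x : P F G), tmor (tstr H x) = tstr H (tmor x)
}.

Section TambMorOps.
Variables (k : fieldType) (C : StrictMonCat k).
Implicit Types P Q R : Tamb C.

Lemma tambmor_ext P Q (s t : TambMor P Q) :
  (forall F G (x : P F G), s F G x = t F G x) -> s = t.
Proof.
case: s t => [s s1 s2 s3] [t t1 t2 t3] /= st.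
have e : s = t.
  do 2![apply: functional_extensionality_dep => ?]; exact: funext.
by case: _ / e t1 t2 t3 {st} => *; congr MkTambMor; apply: Prop_irrelevance.
Qed.

Definition tambmor_id P : TambMor P P :=
  @MkTambMor k C P P (fun F G x => x) (fun F G a u v => erefl)
    (fun F F' G G' f g x => erefl) (fun H F G x => erefl).

Lemma tambmor_comp_lin P Q R (t : TambMor Q R) (s : TambMor P Q) F G :
  linear (fun x : P F G => t F G (s F G x)).
Proof. by move=> a u v; rewrite !tmor_lin. Qed.

Lemma tambmor_comp_nat P Q R (t : TambMor Q R) (s : TambMor P Q) F F' G G'
  (f : lhom F' F) (g : lhom G G') (x : P F G) :
  t _ _ (s _ _ (tmap f g x)) = tmap f g (t _ _ (s _ _ x)).
Proof. by rewrite !tmor_nat. Qed.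

Lemma tambmor_comp_str P Q R (t : TambMor Q R) (s : TambMor P Q) H F G
  (x : P F G) : t _ _ (s _ _ (tstr H x)) = tstr H (t _ _ (s _ _ x)).
Proof. by rewrite !tmor_str. Qed.

Definition tambmor_comp P Q R (t : TambMor Q R) (s : TambMor P Q) :
    TambMor P R :=
  MkTambMor (tambmor_comp_lin t s) (@tambmor_comp_nat P Q R t s)
    (tambmor_comp_str t s).

Lemma tmap_idl P (F G G' G'' : C) (g' : lhom G' G'') (g : lhom G G')
  (x : P F G) : tmap (lid F) (g' \c g) x = tmap (lid F) g' (tmap (lid F) g x).
Proof. by rewrite -tmap_comp lcomp1l. Qed.

End TambMorOps.

Section TambUnit.
Variables (k : fieldType) (C : StrictMonCat k).

Let uob (F G : C) : lmodType k := lhom F G.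
Let umap (F F' G G' : C) (f : lhom F' F) (g : lhom G G') (x : uob F G) :
  uob F' G' := g \c x \c f.
Let ustr (H F G : C) (x : uob F G) : uob (tens H F) (tens H G) :=
  tensm (lid H) x.

Lemma tamb_unit_subproof1 F F' G G' (f : lhom F' F) (g : lhom G G') :
  linear (umap f g).
Proof. by move=> a u v; rewrite /umap lcomp_linr lcomp_linl. Qed.

Lemma tamb_unit_subproof2 F F' G G' (g : lhom G G') (x : uob F G) :
  linear (fun f : lhom F' F => umap f g x).
Proof. by move=> a u v; rewrite /umap lcomp_linr. Qed.

Lemma tamb_unit_subproof3 F F' G G' (f : lhom F' F) (x : uob F G) :
  linear (fun g : lhom G G' => umap f g x).
Proof. by move=> a u v; rewrite /umap !lcomp_linl. Qed.

Lemma tamb_unit_subproof4 F G (x : uob F G) : umap (lid F) (lid G) x = x.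
Proof. by rewrite /umap lcomp1l lcomp1r. Qed.

Lemma tamb_unit_subproof5 F F' F'' G G' G'' (f' : lhom F'' F')
  (f : lhom F' F) (g' : lhom G' G'') (g : lhom G G') (x : uob F G) :
  umap (f \c f') (g' \c g) x = umap f' g' (umap f g x).
Proof. by rewrite /umap !lcompA. Qed.

Lemma tamb_unit_subproof6 H F G : linear (@ustr H F G).
Proof. exact: tensm_linr. Qed.

Lemma tamb_unit_subproof7 H F F' G G' (f : lhom F' F) (g : lhom G G')
  (x : uob F G) :
  ustr H (umap f g x) = umap (tensm (lid H) f) (tensm (lid H) g) (ustr H x).
Proof. by rewrite /ustr /umap -!tensm_comp !lcomp1l. Qed.

Lemma tamb_unit_subproof8 H K (h : lhom H K) F G (x : uob F G) :
  umap (lid (tens H F)) (tensm h (lid G)) (ustr H x)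
    = umap (tensm h (lid F)) (lid (tens K G)) (ustr K x).
Proof.
by rewrite /ustr /umap lcomp1r lcomp1l -!tensm_comp !lcomp1l !lcomp1r.
Qed.

Lemma tamb_unit_subproof9 F G (x : uob F G) :
  ustr (sunit C) x = umap (idto (tens1o F)) (idto (esym (tens1o G))) x.
Proof.
by rewrite /ustr /umap -lcompA -tens1m lcompA idtoK lcomp1l.
Qed.

Lemma tamb_unit_subproof10 K H F G (x : uob F G) :
  ustr (tens K H) x
    = umap (idto (esym (tensA K H F))) (idto (tensA K H G))
        (ustr K (ustr H x)).
Proof. by rewrite /ustr /umap tensmA tensm_id idtoKr. Qed.

Definition tamb_unit : Tamb C :=
  MkTamb tamb_unit_subproof1 tamb_unit_subproof2 tamb_unit_subproof3
    tamb_unit_subproof4 tamb_unit_subproof5 tamb_unit_subproof6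
    tamb_unit_subproof7 tamb_unit_subproof8 tamb_unit_subproof9
    tamb_unit_subproof10.

End TambUnit.

(* The coend [int^H P(F,H) (x) Q(H,G)], as the vector space presented by the
   generators [CGen H x y], standing for [x (x) y] in the summand of index [H],
   and the relations [crel]: the axioms of a vector space, bilinearity, and
   dinaturality in [H].  Its universal property is [coend_lift], with
   [coend_liftE] and [coend_ext].  That it is again an [lmodType] bounds the
   universe of the objects of [C]: [C] is small. *)
Section CoendDef.
Variables (k : fieldType) (C : StrictMonCat k) (P Q : Tamb C) (F G : C).

Inductive cterm : Type :=
| CZero
| CAdd (s t : cterm)
| CScale (a : k) (t : cterm)
| CGen (H : C) (x : P F H) (y : Q H G).

Inductive crel : cterm -> cterm -> Prop :=
| crel_refl t : crel t t
| crel_sym s t : crel s t -> crel t s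
| crel_trans s t u : crel s t -> crel t u -> crel s u
| crel_congD s s' t t' : crel s s' -> crel t t' -> crel (CAdd s t) (CAdd s' t')
| crel_congZ a t t' : crel t t' -> crel (CScale a t) (CScale a t')
| crel_addA s t u : crel (CAdd s (CAdd t u)) (CAdd (CAdd s t) u)
| crel_addC s t : crel (CAdd s t) (CAdd t s)
| crel_add0 t : crel (CAdd CZero t) t
| crel_addN t : crel (CAdd (CScale (- 1) t) t) CZero
| crel_scaleA a b t : crel (CScale a (CScale b t)) (CScale (a * b) t)
| crel_scale1 t : crel (CScale 1 t) t
| crel_scaleDr a s t :
    crel (CScale a (CAdd s t)) (CAdd (CScale a s) (CScale a t))
| crel_scaleDl t a b :
    crel (CScale (a + b) t) (CAdd (CScale a t) (CScale b t))
| crel_linl H a (x x' : P F H) (y : Q H G) :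
    crel (CGen (a *: x + x') y) (CAdd (CScale a (CGen x y)) (CGen x' y))
| crel_linr H a (x : P F H) (y y' : Q H G) :
    crel (CGen x (a *: y + y')) (CAdd (CScale a (CGen x y)) (CGen x y'))
| crel_dinat H H' (h : lhom H H') (x : P F H) (y : Q H' G) :
    crel (CGen (tmap (lid F) h x) y) (CGen x (tmap h (lid G) y)).

HB.instance Definition _ := gen_eqMixin cterm.
HB.instance Definition _ := gen_choiceMixin cterm.

Let crelb : rel cterm := fun s t => `[< crel s t >].

Lemma crelb_refl : reflexive crelb.
Proof. by move=> t; apply/asboolP; apply: crel_refl. Qed.

Lemma crelb_sym : symmetric crelb.
Proof. by move=> s t; apply/asboolP/asboolP; apply: crel_sym. Qed.

Lemma crelb_trans : transitive crelb.
Proof.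
by move=> t s u /asboolP st /asboolP tu; apply/asboolP; apply: crel_trans tu.
Qed.

Definition crel_equiv := EquivRel crelb crelb_refl crelb_sym crelb_trans.

Definition coend : Type := {eq_quot crel_equiv}.
HB.instance Definition _ := Choice.on coend.

Definition cls (t : cterm) : coend := \pi_{eq_quot crel_equiv} t.
Definition rep (u : coend) : cterm := repr u.

Lemma repK u : cls (rep u) = u.
Proof. exact: reprK. Qed.

Lemma clsP s t : cls s = cls t <-> crel s t.
Proof.
split=> [/eqP|st].
  by rewrite eqmodE => /asboolP.
by apply/eqP; rewrite eqmodE; apply/asboolP.
Qed.

Lemma rep_cls t : crel (rep (cls t)) t.
Proof. by apply/clsP; rewrite repK. Qed.

Definition cadd (u v : coend) : coend := cls (CAdd (rep u) (rep v)).
Definition cscale (a : k) (u : coend) : coend := cls (CScale a (rep u)).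
Definition czero : coend := cls CZero.
Definition copp (u : coend) : coend := cscale (- 1) u.

Lemma caddE s t : cadd (cls s) (cls t) = cls (CAdd s t).
Proof. by apply/clsP; apply: crel_congD; apply: rep_cls. Qed.

Lemma cscaleE a t : cscale a (cls t) = cls (CScale a t).
Proof. by apply/clsP; apply: crel_congZ; apply: rep_cls. Qed.

Lemma caddA : associative cadd.
Proof.
move=> u v w; rewrite -(repK u) -(repK v) -(repK w) !caddE.
by apply/clsP; apply: crel_addA.
Qed.

Lemma caddC : commutative cadd.
Proof.
move=> u v; rewrite -(repK u) -(repK v) !caddE.
by apply/clsP; apply: crel_addC.
Qed.

Lemma cadd0 : left_id czero cadd.
Proof. by move=> u; rewrite -(repK u) caddE; apply/clsP/crel_add0. Qed.

Lemma caddN : left_inverse czero copp cadd.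
Proof. by move=> u; rewrite -(repK u) /copp cscaleE caddE; apply/clsP/crel_addN. Qed.

HB.instance Definition _ := GRing.isZmodule.Build coend caddA caddC cadd0 caddN.

Lemma cscaleA a b u : cscale a (cscale b u) = cscale (a * b) u.
Proof. by rewrite -(repK u) !cscaleE; apply/clsP/crel_scaleA. Qed.

Lemma cscale1 : left_id 1 cscale.
Proof. by move=> u; rewrite -(repK u) cscaleE; apply/clsP/crel_scale1. Qed.

Lemma cscaleDr : right_distributive cscale +%R.
Proof.
move=> a u v; rewrite /GRing.add /= -(repK u) -(repK v) !(caddE, cscaleE).
exact/clsP/crel_scaleDr.
Qed.

Lemma cscaleDl u : {morph cscale^~ u : a b / a + b}.
Proof.
move=> a b; rewrite {2}/GRing.add /= -(repK u) !(caddE, cscaleE).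
exact/clsP/crel_scaleDl.
Qed.

HB.instance Definition _ :=
  GRing.Zmodule_isLmodule.Build k coend cscaleA cscale1 cscaleDr cscaleDl.

Definition cgen (H : C) (x : P F H) (y : Q H G) : coend := cls (CGen x y).

Lemma cgen_linl H (y : Q H G) : linear (fun x : P F H => cgen x y).
Proof.
move=> a x x'; rewrite /GRing.add /GRing.scale /= /cgen cscaleE caddE.
exact/clsP/crel_linl.
Qed.

Lemma cgen_linr H (x : P F H) : linear (fun y : Q H G => cgen x y).
Proof.
move=> a y y'; rewrite /GRing.add /GRing.scale /= /cgen cscaleE caddE.
exact/clsP/crel_linr.
Qed.

Lemma cgen_dinat H H' (h : lhom H H') (x : P F H) (y : Q H' G) :
  cgen (tmap (lid F) h x) y = cgen x (tmap h (lid G) y).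
Proof. exact/clsP/crel_dinat. Qed.

Lemma coend_ext (V : lmodType k) (f g : coend -> V) :
  linear f -> linear g ->
  (forall H (x : P F H) (y : Q H G), f (cgen x y) = g (cgen x y)) -> f =1 g.
Proof.
move=> f_lin g_lin fg u; rewrite -(repK u).
elim: (rep u) => [|s IHs t IHt|a t IHt|H x y]; last exact: fg.
- by rewrite (linf0 f_lin) (linf0 g_lin).
- by rewrite -caddE (linfD f_lin) (linfD g_lin) IHs IHt.
- by rewrite -cscaleE (linfZ f_lin) (linfZ g_lin) IHt.
Qed.

Section Lift.
Variables (V : lmodType k) (b : forall H : C, P F H -> Q H G -> V).

Record balanced : Prop := Balanced {
  bal_linl : forall H (y : Q H G), linear (fun x : P F H => b x y);
  bal_linr : forall H (x : P F H), linear (fun y : Q H G => b x y);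
  bal_dinat : forall H H' (h : lhom H H') (x : P F H) (y : Q H' G),
    b (tmap (lid F) h x) y = b x (tmap h (lid G) y)
}.

Fixpoint ceval (t : cterm) : V :=
  match t with
  | CZero => 0
  | CAdd s t => ceval s + ceval t
  | CScale a t => a *: ceval t
  | CGen H x y => b x y
  end.

Definition coend_lift (u : coend) : V := ceval (rep u).

Hypothesis b_bal : balanced.

Lemma ceval_crel s t : crel s t -> ceval s = ceval t.
Proof.
elim=> //=.
- by move=> s' t' u _ -> _ ->.
- by move=> s1 s2 t1 t2 _ -> _ ->.
- by move=> a t1 t2 _ ->.
- by move=> *; rewrite addrA.
- by move=> *; rewrite addrC.
- by move=> *; rewrite add0r.
- by move=> *; rewrite scaleN1r addNr.
- by move=> *; rewrite scalerA.
- by move=> *; rewrite scale1r.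
- by move=> *; rewrite scalerDr.
- by move=> *; rewrite scalerDl.
- by move=> H a x x' y; rewrite (bal_linl b_bal).
- by move=> H a x y y'; rewrite (bal_linr b_bal).
- by move=> *; rewrite (bal_dinat b_bal).
Qed.

Lemma coend_lift_cls t : coend_lift (cls t) = ceval t.
Proof. exact/ceval_crel/rep_cls. Qed.

Lemma coend_lift_lin : linear coend_lift.
Proof.
move=> a u v; rewrite /GRing.add /GRing.scale /=.
rewrite -(repK u) -(repK v) !(caddE, cscaleE).
by rewrite !coend_lift_cls.
Qed.

Lemma coend_liftE H (x : P F H) (y : Q H G) : coend_lift (cgen x y) = b x y.
Proof. exact: coend_lift_cls. Qed.

End Lift.
End CoendDef.

Arguments cgen {k C P Q F G} H x y.
Arguments coend_lift {k C P Q F G V} b u.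
Arguments coend_ext {k C P Q F G V} f g.

Section TambTensor.
Variables (k : fieldType) (C : StrictMonCat k) (P Q : Tamb C).

Let dob (F G : C) : lmodType k := coend P Q F G.

Let bmap (F F' G G' : C) (f : lhom F' F) (g : lhom G G') H
  (x : P F H) (y : Q H G) : dob F' G' :=
  cgen H (tmap f (lid H) x) (tmap (lid H) g y).

Lemma bmap_bal F F' G G' (f : lhom F' F) (g : lhom G G') :
  balanced (bmap f g).
Proof.
split=> [H y|H x|H H' h x y]; rewrite /bmap.
- by apply: (linear_comp (cgen_linl _)); apply: tmap_lin.
- by apply: (linear_comp (cgen_linr _)); apply: tmap_lin.
- have -> : tmap f (lid H') (tmap (lid F) h x)
    = tmap (lid F') h (tmap f (lid H) x).
    by rewrite -!tmap_comp !lcomp1l !lcomp1r.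
  rewrite cgen_dinat; congr (cgen _ _ _).
  by rewrite -!tmap_comp !lcomp1l !lcomp1r.
Qed.

Let dmap (F F' G G' : C) (f : lhom F' F) (g : lhom G G') :
  dob F G -> dob F' G' := coend_lift (bmap f g).

Let bstr (H F G : C) K (x : P F K) (y : Q K G) :
  dob (tens H F) (tens H G) := cgen (tens H K) (tstr H x) (tstr H y).

Lemma bstr_bal H F G : balanced (@bstr H F G).
Proof.
split=> [K y|K x|K K' h x y]; rewrite /bstr.
- by apply: (linear_comp (cgen_linl _)); apply: tstr_lin.
- by apply: (linear_comp (cgen_linr _)); apply: tstr_lin.
- by rewrite !tstr_nat !tensm_id cgen_dinat.
Qed.

Let dstr (H F G : C) : dob F G -> dob (tens H F) (tens H G) :=
  coend_lift (@bstr H F G).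

Lemma tamb_tens_subproof1 F F' G G' (f : lhom F' F) (g : lhom G G') :
  linear (dmap f g).
Proof. exact: coend_lift_lin (bmap_bal f g). Qed.

Let dmapE F F' G G' (f : lhom F' F) (g : lhom G G') H (x : P F H) (y : Q H G) :
  dmap f g (cgen H x y) = cgen H (tmap f (lid H) x) (tmap (lid H) g y).
Proof. exact: (coend_liftE (bmap_bal f g)). Qed.

Let dstrE H F G K (x : P F K) (y : Q K G) :
  dstr H (cgen K x y) = cgen (tens H K) (tstr H x) (tstr H y).
Proof. exact: (coend_liftE (bstr_bal H F G)). Qed.

Lemma linear_pencil (U V : lmodType k) (f g : U -> V) a :
  linear f -> linear g -> linear (fun x => a *: f x + g x).
Proof.
move=> f_lin g_lin c u v; rewrite f_lin g_lin !scalerDr !scalerA (mulrC a).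
by rewrite addrACA.
Qed.

Lemma tamb_tens_subproof2 F F' G G' (g : lhom G G') (x : dob F G) :
  linear (fun f : lhom F' F => dmap f g x).
Proof.
move=> a f f'; move: x.
apply: coend_ext; [exact: tamb_tens_subproof1| |move=> H x y].
  by apply: linear_pencil; apply: tamb_tens_subproof1.
by rewrite !dmapE tmap_linl cgen_linl.
Qed.

Lemma tamb_tens_subproof3 F F' G G' (f : lhom F' F) (x : dob F G) :
  linear (fun g : lhom G G' => dmap f g x).
Proof.
move=> a g g'; move: x.
apply: coend_ext; [exact: tamb_tens_subproof1| |move=> H x y].
  by apply: linear_pencil; apply: tamb_tens_subproof1.
by rewrite !dmapE tmap_linr cgen_linr.
Qed.

Lemma tamb_tens_subproof4 F G (x : dob F G) : dmap (lid F) (lid G) x = x.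
Proof.
move: x; apply: (coend_ext (dmap (lid F) (lid G)) id) => //.
  exact: tamb_tens_subproof1.
by move=> H x y; rewrite dmapE !tmap_id.
Qed.

Lemma tamb_tens_subproof5 F F' F'' G G' G'' (f' : lhom F'' F')
  (f : lhom F' F) (g' : lhom G' G'') (g : lhom G G') (x : dob F G) :
  dmap (f \c f') (g' \c g) x = dmap f' g' (dmap f g x).
Proof.
move: x; apply: coend_ext; first exact: tamb_tens_subproof1.
  by apply: linear_comp; apply: tamb_tens_subproof1.
by move=> H x y; rewrite !dmapE -!tmap_comp !lcomp1l.
Qed.

Lemma tamb_tens_subproof6 H F G : linear (@dstr H F G).
Proof. exact: coend_lift_lin (bstr_bal H F G). Qed.

Lemma tamb_tens_subproof7 H F F' G G' (f : lhom F' F) (g : lhom G G')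
  (x : dob F G) :
  dstr H (dmap f g x) = dmap (tensm (lid H) f) (tensm (lid H) g) (dstr H x).
Proof.
move: x; apply: coend_ext.
- by apply: linear_comp; [apply: tamb_tens_subproof6|apply: tamb_tens_subproof1].
- by apply: linear_comp; [apply: tamb_tens_subproof1|apply: tamb_tens_subproof6].
by move=> K x y; rewrite dmapE !dstrE dmapE !tstr_nat !tensm_id.
Qed.

Lemma tamb_tens_subproof8 H K (h : lhom H K) F G (x : dob F G) :
  dmap (lid (tens H F)) (tensm h (lid G)) (dstr H x)
    = dmap (tensm h (lid F)) (lid (tens K G)) (dstr K x).
Proof.
move: x; apply: coend_ext.
- by apply: linear_comp; [apply: tamb_tens_subproof1|apply: tamb_tens_subproof6].
- by apply: linear_comp; [apply: tamb_tens_subproof1|apply: tamb_tens_subproof6].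
move=> L x y; rewrite !dstrE !dmapE !tmap_id tstr_dinat -cgen_dinat.
by rewrite tstr_dinat.
Qed.

Lemma tamb_tens_subproof9 F G (x : dob F G) :
  dstr (sunit C) x = dmap (idto (tens1o F)) (idto (esym (tens1o G))) x.
Proof.
move: x; apply: coend_ext; first exact: tamb_tens_subproof6.
  exact: tamb_tens_subproof1.
move=> H x y; rewrite dstrE dmapE !tstr_one.
have -> : tmap (idto (tens1o F)) (idto (esym (tens1o H))) x
  = tmap (lid _) (idto (esym (tens1o H))) (tmap (idto (tens1o F)) (lid _) x).
  by rewrite -tmap_comp !lcomp1r.
by rewrite cgen_dinat -tmap_comp lcomp1l idtoK.
Qed.

Lemma tamb_tens_subproof10 K H F G (x : dob F G) :
  dstr (tens K H) x
    = dmap (idto (esym (tensA K H F))) (idto (tensA K H G))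
        (dstr K (dstr H x)).
Proof.
move: x; apply: coend_ext; first exact: tamb_tens_subproof6.
  apply: linear_comp; first exact: tamb_tens_subproof1.
  by apply: linear_comp; exact: tamb_tens_subproof6.
move=> L x y; rewrite !dstrE dmapE !tstr_tens.
set u := tstr K (tstr H x); set v := tstr K (tstr H y).
have -> : tmap (idto (esym (tensA K H F))) (idto (tensA K H L)) u
  = tmap (lid _) (idto (tensA K H L)) (tmap (idto (esym (tensA K H F))) (lid _) u).
  by rewrite -tmap_comp !lcomp1r.
by rewrite cgen_dinat -tmap_comp lcomp1l idtoK.
Qed.

Definition tamb_tens : Tamb C :=
  MkTamb tamb_tens_subproof1 tamb_tens_subproof2 tamb_tens_subproof3
    tamb_tens_subproof4 tamb_tens_subproof5 tamb_tens_subproof6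
    tamb_tens_subproof7 tamb_tens_subproof8 tamb_tens_subproof9
    tamb_tens_subproof10.

Definition tgen F G H (x : P F H) (y : Q H G) : tamb_tens F G := cgen H x y.

Lemma tmap_tgen F F' G G' (f : lhom F' F) (g : lhom G G') H (x : P F H)
  (y : Q H G) :
  tmap f g (tgen x y) = tgen (tmap f (lid H) x) (tmap (lid H) g y).
Proof. exact: dmapE. Qed.

Lemma tstr_tgen H F G K (x : P F K) (y : Q K G) :
  tstr H (tgen x y) = tgen (tstr H x) (tstr H y).
Proof. exact: dstrE. Qed.

Lemma tgen_linl F G H (y : Q H G) : linear (fun x : P F H => tgen x y).
Proof. exact: cgen_linl. Qed.

Lemma tgen_linr F G H (x : P F H) : linear (fun y : Q H G => tgen x y).
Proof. exact: cgen_linr. Qed.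

Lemma tgen_dinat F G H H' (h : lhom H H') (x : P F H) (y : Q H' G) :
  tgen (tmap (lid F) h x) y = tgen x (tmap h (lid G) y).
Proof. exact: cgen_dinat. Qed.

Lemma tens_ext (V : lmodType k) F G (f g : tamb_tens F G -> V) :
  linear f -> linear g ->
  (forall H (x : P F H) (y : Q H G), f (tgen x y) = g (tgen x y)) -> f =1 g.
Proof. exact: coend_ext. Qed.

Lemma tambmor_tens_ext (R : Tamb C) (s t : TambMor tamb_tens R) :
  (forall F G H (x : P F H) (y : Q H G),
     s F G (tgen x y) = t F G (tgen x y)) -> s = t.
Proof.
move=> st; apply: tambmor_ext => F G.
by apply: tens_ext; [exact: tmor_lin..|exact: st].
Qed.

Section MorLift.
Variables (R : Tamb C) (b : forall F G H : C, P F H -> Q H G -> R F G).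

Record tbalanced : Prop := TBalanced {
  tbal_bal : forall F G, balanced (@b F G);
  tbal_nat : forall F F' G G' (f : lhom F' F) (g : lhom G G') H (x : P F H)
      (y : Q H G),
    b (tmap f (lid H) x) (tmap (lid H) g y) = tmap f g (b x y);
  tbal_str : forall H F G K (x : P F K) (y : Q K G),
    b (tstr H x) (tstr H y) = tstr H (b x y)
}.

Hypothesis b_bal : tbalanced.

Lemma tamb_lift_lin F G : linear (coend_lift (@b F G)).
Proof. exact: coend_lift_lin (tbal_bal b_bal F G). Qed.

Lemma tamb_lift_nat F F' G G' (f : lhom F' F) (g : lhom G G')
  (x : tamb_tens F G) :
  coend_lift (@b F' G') (tmap f g x) = tmap f g (coend_lift (@b F G) x).
Proof.
move: x; apply: tens_ext.
- by apply: linear_comp; [apply: tamb_lift_lin|apply: tmap_lin].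
- by apply: linear_comp; [apply: tmap_lin|apply: tamb_lift_lin].
move=> H x y; rewrite tmap_tgen.
by rewrite !(coend_liftE (tbal_bal b_bal _ _)) (tbal_nat b_bal).
Qed.

Lemma tamb_lift_str H F G (x : tamb_tens F G) :
  coend_lift (@b (tens H F) (tens H G)) (tstr H x)
    = tstr H (coend_lift (@b F G) x).
Proof.
move: x; apply: tens_ext.
- by apply: linear_comp; [apply: tamb_lift_lin|apply: tstr_lin].
- by apply: linear_comp; [apply: tstr_lin|apply: tamb_lift_lin].
move=> K x y; rewrite tstr_tgen.
by rewrite !(coend_liftE (tbal_bal b_bal _ _)) (tbal_str b_bal).
Qed.

Definition tamb_lift : TambMor tamb_tens R :=
  @MkTambMor k C tamb_tens R (fun F G => coend_lift (@b F G))
    tamb_lift_lin tamb_lift_nat tamb_lift_str.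

Lemma tamb_liftE F G H (x : P F H) (y : Q H G) :
  tamb_lift F G (tgen x y) = b x y.
Proof. exact: (coend_liftE (tbal_bal b_bal F G)). Qed.

End MorLift.
End TambTensor.

Record Cat : Type := MkCat {
  cob :> Type;
  chom : cob -> cob -> Type;
  catid : forall X, chom X X;
  ccomp : forall X Y Z, chom Y Z -> chom X Y -> chom X Z;
  ccompA : forall W X Y Z (h : chom Y Z) (g : chom X Y) (f : chom W X),
    ccomp h (ccomp g f) = ccomp (ccomp h g) f;
  ccomp1l : forall X Y (f : chom X Y), ccomp (catid Y) f = f;
  ccomp1r : forall X Y (f : chom X Y), ccomp f (catid X) = f
}.

Declare Scope cat_scope.
Delimit Scope cat_scope with cat.
Local Open Scope cat_scope.
Notation "g \v f" := (ccomp g f) : cat_scope.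

Definition cidto (D : Cat) (X Y : D) (e : X = Y) : chom X Y :=
  match e in _ = Z return chom X Z with erefl => catid X end.

Lemma cidtoK (D : Cat) (X Y : D) (e : X = Y) :
  cidto e \v cidto (esym e) = catid Y /\ cidto (esym e) \v cidto e = catid X.
Proof. by case: _ / e; rewrite ccomp1l. Qed.

Record Functor (D E : Cat) : Type := MkFunctor {
  ctob :> D -> E;
  ctmor : forall X Y : D, chom X Y -> chom (ctob X) (ctob Y);
  ctmor_id : forall X, ctmor (catid X) = catid (ctob X);
  ctmor_comp : forall X Y Z (g : chom Y Z) (f : chom X Y),
    ctmor (g \v f) = ctmor g \v ctmor f
}.

Definition functor_id (D : Cat) : Functor D D :=
  @MkFunctor D D id (fun X Y f => f) (fun X => erefl) (fun X Y Z g f => erefl).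

Lemma functor_comp_id (D E E' : Cat) (G : Functor E E') (F : Functor D E)
  (X : D) : ctmor G (ctmor F (catid X)) = catid (G (F X)).
Proof. by rewrite !ctmor_id. Qed.

Lemma functor_comp_comp (D E E' : Cat) (G : Functor E E') (F : Functor D E)
  (X Y Z : D) (g : chom Y Z) (f : chom X Y) :
  ctmor G (ctmor F (g \v f)) = ctmor G (ctmor F g) \v ctmor G (ctmor F f).
Proof. by rewrite !ctmor_comp. Qed.

Definition functor_comp (D E E' : Cat) (G : Functor E E') (F : Functor D E) :
    Functor D E' :=
  MkFunctor (functor_comp_id G F) (functor_comp_comp G F).

Record NatIso (D E : Cat) (F G : Functor D E) : Type := MkNatIso {
  nicomp : forall X : D, chom (F X) (G X);
  niinv : forall X : D, chom (G X) (F X);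
  nicompK : forall X, niinv X \v nicomp X = catid (F X);
  niinvK : forall X, nicomp X \v niinv X = catid (G X);
  ninat : forall X Y (f : chom X Y),
    nicomp Y \v ctmor F f = ctmor G f \v nicomp X
}.

Definition cat_equivalence (D E : Cat) (F : Functor D E) : Prop :=
  exists G : Functor E D,
    inhabited (NatIso (functor_comp G F) (functor_id D)) /\
    inhabited (NatIso (functor_comp F G) (functor_id E)).

Record MonCat : Type := MkMonCat {
  vcat :> Cat;
  vtens : vcat -> vcat -> vcat;
  vtensm : forall A A' B B' : vcat,
    chom A A' -> chom B B' -> chom (vtens A B) (vtens A' B');
  vunit : vcat;
  vassoc : forall A B D, chom (vtens (vtens A B) D) (vtens A (vtens B D));
  vassocV : forall A B D, chom (vtens A (vtens B D)) (vtens (vtens A B) D);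
  vlam : forall A, chom (vtens vunit A) A;
  vlamV : forall A, chom A (vtens vunit A);
  vrho : forall A, chom (vtens A vunit) A;
  vrhoV : forall A, chom A (vtens A vunit);
  vtensm_id : forall A B, vtensm (catid A) (catid B) = catid (vtens A B);
  vtensm_comp : forall A A' A'' B B' B'' (f' : chom A' A'') (f : chom A A')
      (g' : chom B' B'') (g : chom B B'),
    vtensm (f' \v f) (g' \v g) = vtensm f' g' \v vtensm f g;
  vassocK : forall A B D, vassocV A B D \v vassoc A B D = catid _;
  vassocVK : forall A B D, vassoc A B D \v vassocV A B D = catid _;
  vlamK : forall A, vlamV A \v vlam A = catid _;
  vlamVK : forall A, vlam A \v vlamV A = catid _;
  vrhoK : forall A, vrhoV A \v vrho A = catid _;
  vrhoVK : forall A, vrho A \v vrhoV A = catid _;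
  vassoc_nat : forall A A' B B' D D' (f : chom A A') (g : chom B B')
      (h : chom D D'),
    vassoc A' B' D' \v vtensm (vtensm f g) h
      = vtensm f (vtensm g h) \v vassoc A B D;
  vlam_nat : forall A A' (f : chom A A'),
    vlam A' \v vtensm (catid vunit) f = f \v vlam A;
  vrho_nat : forall A A' (f : chom A A'),
    vrho A' \v vtensm f (catid vunit) = f \v vrho A;
  vpentagon : forall A B D E,
    vassoc A B (vtens D E) \v vassoc (vtens A B) D E
      = vtensm (catid A) (vassoc B D E) \v vassoc A (vtens B D) E
          \v vtensm (vassoc A B D) (catid E);
  vtriangle : forall A B,
    vtensm (catid A) (vlam B) \v vassoc A vunit B = vtensm (vrho A) (catid B)
}.

Arguments vassoc {m} A B D : rename.
Arguments vassocV {m} A B D : rename.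
Arguments vlam {m} A : rename.
Arguments vlamV {m} A : rename.
Arguments vrho {m} A : rename.
Arguments vrhoV {m} A : rename.
Arguments vunit {m}.

Section MonFacts.
Variable V : MonCat.
Implicit Types A B D E : V.

Lemma cancel_epi A B D (i : chom A B) (j : chom B A) (f g : chom B D) :
  i \v j = catid B -> f \v i = g \v i -> f = g.
Proof.
by move=> ij fg; rewrite -(ccomp1r f) -(ccomp1r g) -ij !ccompA fg.
Qed.

Lemma cancel_mono A B D (i : chom A B) (j : chom B A) (f g : chom D A) :
  j \v i = catid A -> i \v f = i \v g -> f = g.
Proof.
by move=> ji fg; rewrite -(ccomp1l f) -(ccomp1l g) -ji -!ccompA fg.
Qed.

Lemma vtensm_split A A' B B' (f : chom A A') (g : chom B B') :
  vtensm f g = vtensm f (catid B') \v vtensm (catid A) g.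
Proof. by rewrite -vtensm_comp ccomp1l ccomp1r. Qed.

Lemma vtensm_split' A A' B B' (f : chom A A') (g : chom B B') :
  vtensm f g = vtensm (catid A') g \v vtensm f (catid B).
Proof. by rewrite -vtensm_comp ccomp1l ccomp1r. Qed.

Lemma vlamV_nat A A' (f : chom A A') :
  vlamV A' \v f = vtensm (catid vunit) f \v vlamV A.
Proof.
apply: (cancel_mono (vlamK A')).
by rewrite !ccompA vlamVK vlam_nat -ccompA vlamVK ccomp1l ccomp1r.
Qed.

Lemma vrhoV_nat A A' (f : chom A A') :
  vrhoV A' \v f = vtensm f (catid vunit) \v vrhoV A.
Proof.
apply: (cancel_mono (vrhoK A')).
by rewrite !ccompA vrhoVK vrho_nat -ccompA vrhoVK ccomp1l ccomp1r.
Qed.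

Lemma vassocV_nat A A' B B' D D' (f : chom A A') (g : chom B B')
  (h : chom D D') :
  vassocV A' B' D' \v vtensm f (vtensm g h)
    = vtensm (vtensm f g) h \v vassocV A B D.
Proof.
apply: (cancel_mono (vassocK A' B' D')).
by rewrite !ccompA vassocVK vassoc_nat -ccompA vassocVK ccomp1l ccomp1r.
Qed.

Lemma vtensI_inj A B (f g : chom A B) :
  vtensm (catid vunit) f = vtensm (catid vunit) g -> f = g.
Proof.
move=> fg; apply: (cancel_epi (vlamVK A)).
by rewrite -!vlam_nat fg.
Qed.

Lemma vtensI_inj' A B (f g : chom A B) :
  vtensm f (catid vunit) = vtensm g (catid vunit) -> f = g.
Proof.
move=> fg; apply: (cancel_epi (vrhoVK A)).
by rewrite -!vrho_nat fg.
Qed.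

Lemma vlam_tens A B : vlam (vtens A B) \v vassoc vunit A B = vtensm (vlam A) (catid B).
Proof.
apply: vtensI_inj.
apply: (cancel_epi (vassocVK vunit (vtens vunit A) B)).
have iso : vtensm (vassoc vunit vunit A) (catid B)
    \v vtensm (vassocV vunit vunit A) (catid B) = catid _.
  by rewrite -vtensm_comp vassocVK ccomp1l vtensm_id.
apply: (cancel_epi iso).
rewrite -{1}(ccomp1l (catid vunit)) vtensm_comp -!ccompA.
rewrite [vtensm (catid _) (vassoc _ _ _) \v _]ccompA -vpentagon.
rewrite ccompA vtriangle -vtensm_id -vassoc_nat.
rewrite -vtriangle -{1}(ccomp1l (catid B)) vtensm_comp !ccompA.
by rewrite vassoc_nat.
Qed.

Lemma vlam_unit_tens A : vlam (vtens vunit A) = vtensm (catid vunit) (vlam A).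
Proof.
by apply: (cancel_mono (vlamK A)); rewrite vlam_nat.
Qed.

Lemma vlam_rho : vlam vunit = vrho vunit :> chom (vtens (vunit : V) _) _.
Proof.
by apply: vtensI_inj'; rewrite -vlam_tens vlam_unit_tens vtriangle.
Qed.

Lemma vlamV_rhoV : vlamV vunit = vrhoV vunit :> chom _ (vtens (vunit : V) _).
Proof.
by apply: (cancel_mono (vlamK vunit)); rewrite vlamVK vlam_rho vrhoVK.
Qed.

Lemma vtriangleV A B :
  vassocV A vunit B \v vtensm (catid A) (vlamV B) = vtensm (vrhoV A) (catid B).
Proof.
have iso : vtensm (vrhoV A) (catid B) \v vtensm (vrho A) (catid B) = catid _.
  by rewrite -vtensm_comp vrhoK ccomp1l vtensm_id.
apply: (cancel_mono iso).
rewrite -vtensm_comp vrhoVK ccomp1l vtensm_id -vtriangle.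
rewrite -ccompA [vassoc _ _ _ \v _]ccompA vassocVK ccomp1l -vtensm_comp.
by rewrite ccomp1l vlamVK vtensm_id.
Qed.

End MonFacts.

Section MonRev.
Variable V : MonCat.

Lemma mon_rev_pentagon (A B D E : V) :
  vassocV (vtens E D) B A \v vassocV E D (vtens B A)
    = vtensm (vassocV E D B) (catid A) \v vassocV E (vtens D B) A
        \v vtensm (catid E) (vassocV D B A).
Proof.
have VK : vassoc E D (vtens B A) \v vassoc (vtens E D) B A
    \v (vassocV (vtens E D) B A \v vassocV E D (vtens B A)) = catid _.
  rewrite ccompA -[_ \v vassoc (vtens E D) B A \v _]ccompA vassocVK ccomp1r.
  exact: vassocVK.
apply: (cancel_epi VK).
have -> : vassocV (vtens E D) B A \v vassocV E D (vtens B A)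
    \v (vassoc E D (vtens B A) \v vassoc (vtens E D) B A) = catid _.
  rewrite ccompA -[_ \v vassocV E D _ \v _]ccompA vassocK ccomp1r.
  exact: vassocK.
rewrite vpentagon !ccompA -[_ \v vtensm (catid E) (vassocV _ _ _) \v _]ccompA.
rewrite -vtensm_comp vassocK ccomp1l vtensm_id ccomp1r.
rewrite -[_ \v vassocV _ _ _ \v vassoc _ _ _]ccompA vassocK ccomp1r.
by rewrite -vtensm_comp vassocK ccomp1l vtensm_id.
Qed.

Lemma mon_rev_triangle (A B : V) :
  vtensm (vrho B) (catid A) \v vassocV B vunit A = vtensm (catid B) (vlam A).
Proof. by rewrite -vtriangle -ccompA vassocVK ccomp1r. Qed.

Lemma mon_rev_assoc_nat (A A' B B' D D' : V) (f : chom A A')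
  (g : chom B B') (h : chom D D') :
  vassocV D' B' A' \v vtensm h (vtensm g f)
    = vtensm (vtensm h g) f \v vassocV D B A.
Proof. exact: vassocV_nat. Qed.

(* The product of [A] and [B] is [vtens B A]; hence the composition of a category
   enriched in [mon_rev V] is a morphism from
   [vtens (ehom X Y) (ehom Y Z)] of [V]. *)
Definition mon_rev : MonCat :=
  @MkMonCat V (fun A B => vtens B A) (fun A A' B B' f g => vtensm g f) vunit
    (fun A B D => vassocV D B A) (fun A B D => vassoc D B A)
    vrho vrhoV vlam vlamV
    (fun A B => vtensm_id B A)
    (fun A A' A'' B B' B'' f' f g' g => vtensm_comp g' g f' f)
    (fun A B D => vassocVK D B A) (fun A B D => vassocK D B A)
    (@vrhoK V) (@vrhoVK V) (@vlamK V) (@vlamVK V)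
    mon_rev_assoc_nat (@vrho_nat V) (@vlam_nat V)
    mon_rev_pentagon mon_rev_triangle.

End MonRev.

Section MonFacts2.
Variable V : MonCat.

Lemma vrhoV_tens (A B : V) :
  vassocV A B vunit \v vtensm (catid A) (vrhoV B) = vrhoV (vtens A B).
Proof.
apply: (cancel_mono (vrhoK (vtens A B))); rewrite vrhoVK ccompA.
have -> : vrho (vtens A B) \v vassocV A B vunit = vtensm (catid A) (vrho B).
  exact: (@vlam_tens (mon_rev V) B A).
by rewrite -vtensm_comp vrhoVK ccomp1l vtensm_id.
Qed.

End MonFacts2.

(* A strict 2-category: 1-cells compose strictly associatively, and the
   corresponding equations between 2-cells hold modulo [cidto]. *)
Record TwoCat : Type := MkTwoCat {
  ob0 :> Type;
  hom1 : ob0 -> ob0 -> Cat;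
  one1 : forall X, hom1 X X;
  comp1 : forall X Y Z, hom1 Y Z -> hom1 X Y -> hom1 X Z;
  hcomp : forall X Y Z (g g' : hom1 Y Z) (f f' : hom1 X Y),
    chom g g' -> chom f f' -> chom (comp1 g f) (comp1 g' f');
  hcomp_id : forall X Y Z (g : hom1 Y Z) (f : hom1 X Y),
    hcomp (catid g) (catid f) = catid (comp1 g f);
  hcomp_comp : forall X Y Z (g g' g'' : hom1 Y Z) (f f' f'' : hom1 X Y)
      (b' : chom g' g'') (b : chom g g') (a' : chom f' f'') (a : chom f f'),
    hcomp (b' \v b) (a' \v a) = hcomp b' a' \v hcomp b a;
  comp1A : forall W X Y Z (h : hom1 Y Z) (g : hom1 X Y) (f : hom1 W X),
    comp1 h (comp1 g f) = comp1 (comp1 h g) f;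
  comp1_1l : forall X Y (f : hom1 X Y), comp1 (one1 Y) f = f;
  comp1_1r : forall X Y (f : hom1 X Y), comp1 f (one1 X) = f;
  hcompA : forall W X Y Z (h h' : hom1 Y Z) (g g' : hom1 X Y) (f f' : hom1 W X)
      (c : chom h h') (b : chom g g') (a : chom f f'),
    cidto (comp1A h' g' f') \v hcomp c (hcomp b a)
      = hcomp (hcomp c b) a \v cidto (comp1A h g f);
  hcomp1l : forall X Y (f f' : hom1 X Y) (a : chom f f'),
    cidto (comp1_1l f') \v hcomp (catid (one1 Y)) a = a \v cidto (comp1_1l f);
  hcomp1r : forall X Y (f f' : hom1 X Y) (a : chom f f'),
    cidto (comp1_1r f') \v hcomp a (catid (one1 X)) = a \v cidto (comp1_1r f)
}.

Arguments one1 {t} X : rename.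
Arguments hom1 {t} _ _.
Arguments comp1 {t X Y Z} _ _.
Arguments hcomp {t X Y Z g g' f f'} _ _.

Record TwoFunData (A B : TwoCat) : Type := MkTwoFunData {
  tf0 : A -> B;
  tf1 : forall X Y : A, hom1 X Y -> hom1 (tf0 X) (tf0 Y);
  tf2 : forall (X Y : A) (f g : hom1 X Y), chom f g -> chom (tf1 f) (tf1 g)
}.

Record is_two_functor (A B : TwoCat) (S : TwoFunData A B) : Prop :=
  IsTwoFunctor {
  tf2_id : forall (X Y : A) (f : hom1 X Y), tf2 S (catid f) = catid (tf1 S f);
  tf2_comp : forall (X Y : A) (f g h : hom1 X Y) (b : chom g h) (a : chom f g),
    tf2 S (b \v a) = tf2 S b \v tf2 S a;
  tf1_one : forall X : A, tf1 S (one1 X) = one1 (tf0 S X);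
  tf1_comp : forall (X Y Z : A) (g : hom1 Y Z) (f : hom1 X Y),
    tf1 S (comp1 g f) = comp1 (tf1 S g) (tf1 S f);
  tf2_hcomp : forall (X Y Z : A) (g g' : hom1 Y Z) (f f' : hom1 X Y)
      (b : chom g g') (a : chom f f'),
    cidto (tf1_comp g' f') \v tf2 S (hcomp b a)
      = hcomp (tf2 S b) (tf2 S a) \v cidto (tf1_comp g f)
}.

Record TwoFunctor (A B : TwoCat) : Type := MkTwoFunctor {
  tfdata :> TwoFunData A B;
  tfP : is_two_functor tfdata
}.

Definition tf_local (A B : TwoCat) (S : TwoFunctor A B) (X Y : A) :
    Functor (hom1 X Y) (hom1 (tf0 S X) (tf0 S Y)) :=
  @MkFunctor _ _ (fun f => tf1 S f) (fun f g a => tf2 S a)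
    (tf2_id (tfP S) (Y := Y)) (fun f g h b a => tf2_comp (tfP S) b a).

Definition equivalent (A : TwoCat) (X Y : A) : Prop :=
  exists (f : hom1 X Y) (g : hom1 Y X)
    (a : chom (comp1 g f) (one1 X)) (a' : chom (one1 X) (comp1 g f))
    (b : chom (comp1 f g) (one1 Y)) (b' : chom (one1 Y) (comp1 f g)),
    (a \v a' = catid _ /\ a' \v a = catid _) /\
    (b \v b' = catid _ /\ b' \v b = catid _).

Definition full_sub (A : TwoCat) (P : A -> Prop) : TwoCat :=
  @MkTwoCat {X : A | P X}
    (fun X Y => hom1 (sval X) (sval Y))
    (fun X => one1 (sval X))
    (fun X Y Z g f => comp1 g f)
    (fun X Y Z g g' f f' b a => hcomp b a)
    (fun X Y Z g f => hcomp_id g f)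
    (fun X Y Z g g' g'' f f' f'' b' b a' a => hcomp_comp b' b a' a)
    (fun W X Y Z h g f => comp1A h g f)
    (fun X Y f => comp1_1l f)
    (fun X Y f => comp1_1r f)
    (fun W X Y Z h h' g g' f f' c b a => hcompA c b a)
    (fun X Y f f' a => hcomp1l a)
    (fun X Y f f' a => hcomp1r a).

Definition two_equivalence (A B : TwoCat) (S : TwoFunctor A B) : Prop :=
  (forall Y : B, exists X : A, equivalent (tf0 S X) Y) /\
  (forall X Y : A, cat_equivalence (tf_local S X Y)).

Section EssentialImage.
Variables (A B : TwoCat) (S : TwoFunctor A B).

Definition in_ess_image (Y : B) : Prop := exists X : A, equivalent (tf0 S X) Y.

Definition ess_image : TwoCat := full_sub in_ess_image.

Lemma equivalent_refl (X : B) : equivalent X X.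
Proof.
pose e := comp1_1l (one1 X); have [eK eK'] := cidtoK e.
by exists (one1 X), (one1 X), (cidto e), (cidto (esym e)), (cidto e),
  (cidto (esym e)).
Qed.

Definition corestrict_ob (X : A) : ess_image :=
  exist in_ess_image (tf0 S X) (ex_intro _ X (equivalent_refl (tf0 S X))).

Definition corestrict_data : TwoFunData A ess_image :=
  @MkTwoFunData A ess_image corestrict_ob
    (fun X Y f => tf1 S f) (fun X Y f g a => tf2 S a).

Lemma corestrictP : is_two_functor corestrict_data.
Proof.
exact: (@IsTwoFunctor A ess_image corestrict_data
  (fun X Y f => tf2_id (tfP S) f)
  (fun X Y f g h b a => tf2_comp (tfP S) b a)
  (fun X => tf1_one (tfP S) X)
  (fun X Y Z g f => tf1_comp (tfP S) g f)
  (fun X Y Z g g' f f' b a => tf2_hcomp (tfP S) b a)).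
Qed.

Definition corestrict : TwoFunctor A ess_image := MkTwoFunctor corestrictP.

End EssentialImage.

Section TambMon.
Variables (k : fieldType) (C : StrictMonCat k).
Implicit Types P Q R : Tamb C.

Lemma tambmor_compA P P' Q R (t : TambMor Q R) (s : TambMor P' Q)
  (r : TambMor P P') :
  tambmor_comp t (tambmor_comp s r) = tambmor_comp (tambmor_comp t s) r.
Proof. exact: tambmor_ext. Qed.

Lemma tambmor_comp1l P Q (s : TambMor P Q) :
  tambmor_comp (tambmor_id Q) s = s.
Proof. exact: tambmor_ext. Qed.

Lemma tambmor_comp1r P Q (s : TambMor P Q) :
  tambmor_comp s (tambmor_id P) = s.
Proof. exact: tambmor_ext. Qed.

Lemma tambmor_compE P Q R (t : TambMor Q R) (s : TambMor P Q) F G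
  (x : P F G) : tambmor_comp t s F G x = t F G (s F G x).
Proof. by []. Qed.

Lemma tambmor_idE P F G (x : P F G) : tambmor_id P F G x = x.
Proof. by []. Qed.

Definition TambCat : Cat :=
  MkCat tambmor_compA tambmor_comp1l tambmor_comp1r.

Lemma tensm_bal P P' Q Q' (s : TambMor P P') (t : TambMor Q Q') :
  tbalanced (R := tamb_tens P' Q')
    (fun F G H (x : P F H) (y : Q H G) => tgen (s F H x) (t H G y)).
Proof.
split=> [F G|F F' G G' f g H x y|H F G K x y].
- split=> [H y|H x|H H' h x y].
  + by apply: (linear_comp (tgen_linl _)); apply: tmor_lin.
  + by apply: (linear_comp (tgen_linr _)); apply: tmor_lin.
  + by rewrite !tmor_nat tgen_dinat.
- by rewrite tmap_tgen !tmor_nat.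
- by rewrite tstr_tgen !tmor_str.
Qed.

(* On generators, [x (x) y |-> s x (x) t y]. *)
Definition tamb_tensm P P' Q Q' (s : TambMor P P') (t : TambMor Q Q') :
  TambMor (tamb_tens P Q) (tamb_tens P' Q') := tamb_lift (tensm_bal s t).

Lemma tamb_tensmE P P' Q Q' (s : TambMor P P') (t : TambMor Q Q') F G H
  (x : P F H) (y : Q H G) :
  tamb_tensm s t F G (tgen x y) = tgen (s F H x) (t H G y).
Proof. exact: (tamb_liftE (tensm_bal s t)). Qed.

(* [(x (x) y) (x) z |-> x (x) (y (x) z)]. *)
Lemma assoc1_bal P Q R F K G (z : R K G) :
  balanced (fun H (x : P F H) (y : Q H K) =>
    (tgen x (tgen y z) : tamb_tens P (tamb_tens Q R) F G)).
Proof.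
split=> [H y|H x|H H' h x y].
- exact: tgen_linl.
- by apply: (linear_comp (tgen_linr x)); apply: tgen_linl.
- by rewrite tgen_dinat tmap_tgen tmap_id.
Qed.

Let assoc1 P Q R F G K (u : tamb_tens P Q F K) (z : R K G) :
    tamb_tens P (tamb_tens Q R) F G :=
  coend_lift (fun H (x : P F H) (y : Q H K) =>
    (tgen x (tgen y z) : tamb_tens P (tamb_tens Q R) F G)) u.

Let assoc1E P Q R F G K H (x : P F H) (y : Q H K) (z : R K G) :
  assoc1 (tgen x y) z = tgen x (tgen y z).
Proof. exact: (coend_liftE (@assoc1_bal P Q R F K G z)). Qed.

Let assoc1_linl P Q R F G K (z : R K G) :
  linear (fun u : tamb_tens P Q F K => assoc1 u z).
Proof. exact: (coend_lift_lin (@assoc1_bal P Q R F K G z)). Qed.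

Lemma assoc_bal P Q R :
  tbalanced (R := tamb_tens P (tamb_tens Q R)) (@assoc1 P Q R).
Proof.
split=> [F G|F F' G G' f g K u z|L F G K u z].
- split=> [K z|K u|K K' h u z].
  + exact: assoc1_linl.
  + move=> a z z'; move: u; apply: tens_ext; first exact: assoc1_linl.
      by apply: linear_pencil; apply: assoc1_linl.
    move=> H x y; rewrite !assoc1E.
    by rewrite tgen_linr tgen_linr.
  + move: u; apply: tens_ext.
    * by apply: (linear_comp (assoc1_linl _)); apply: tmap_lin.
    * exact: assoc1_linl.
    move=> H x y; rewrite tmap_tgen !assoc1E tmap_id.
    by rewrite tgen_dinat.
- move: u; apply: tens_ext.
  + by apply: (linear_comp (assoc1_linl _)); apply: tmap_lin.
  + by apply: linear_comp; [apply: tmap_lin|apply: assoc1_linl].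
  by move=> H x y; rewrite tmap_tgen !assoc1E !tmap_tgen !tmap_id.
- move: u; apply: tens_ext.
  + by apply: (linear_comp (assoc1_linl _)); apply: tstr_lin.
  + by apply: linear_comp; [apply: tstr_lin|apply: assoc1_linl].
  by move=> H x y; rewrite tstr_tgen !assoc1E !tstr_tgen.
Qed.

Definition tamb_assoc P Q R :
  TambMor (tamb_tens (tamb_tens P Q) R) (tamb_tens P (tamb_tens Q R)) :=
  tamb_lift (assoc_bal P Q R).

Lemma tamb_assocE P Q R F G H K (x : P F H) (y : Q H K) (z : R K G) :
  tamb_assoc P Q R F G (tgen (tgen x y) z) = tgen x (tgen y z).
Proof. by rewrite (tamb_liftE (assoc_bal P Q R)) assoc1E. Qed.

Lemma assocV1_bal P Q R F H G (x : P F H) :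
  balanced (fun K (y : Q H K) (z : R K G) =>
    (tgen (tgen x y) z : tamb_tens (tamb_tens P Q) R F G)).
Proof.
split=> [K z|K y|K K' h y z].
- by apply: (linear_comp (tgen_linl z)); apply: tgen_linr.
- exact: tgen_linr.
- by rewrite -tgen_dinat tmap_tgen tmap_id.
Qed.

Let assocV1 P Q R F G H (x : P F H) (v : tamb_tens Q R H G) :
    tamb_tens (tamb_tens P Q) R F G :=
  coend_lift (fun K (y : Q H K) (z : R K G) =>
    (tgen (tgen x y) z : tamb_tens (tamb_tens P Q) R F G)) v.

Let assocV1E P Q R F G K H (x : P F H) (y : Q H K) (z : R K G) :
  assocV1 x (tgen y z) = tgen (tgen x y) z.
Proof. exact: (coend_liftE (@assocV1_bal P Q R F H G x)). Qed.

Let assocV1_linr P Q R F G H (x : P F H) :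
  linear (fun v : tamb_tens Q R H G => assocV1 x v).
Proof. exact: (coend_lift_lin (@assocV1_bal P Q R F H G x)). Qed.

Lemma assocV_bal P Q R :
  tbalanced (R := tamb_tens (tamb_tens P Q) R) (@assocV1 P Q R).
Proof.
split=> [F G|F F' G G' f g H x v|L F G H x v].
- split=> [H v|H x|H H' h x v].
  + move=> a x x'; move: v; apply: tens_ext; first exact: assocV1_linr.
      by apply: linear_pencil; apply: assocV1_linr.
    move=> K y z; rewrite !assocV1E.
    by rewrite tgen_linl tgen_linl.
  + exact: assocV1_linr.
  + move: v; apply: tens_ext; first exact: assocV1_linr.
      by apply: (linear_comp (assocV1_linr _)); apply: tmap_lin.
    move=> K y z; rewrite tmap_tgen !assocV1E tmap_id.
    by rewrite -tgen_dinat.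
- move: v; apply: tens_ext.
  + by apply: (linear_comp (assocV1_linr _)); apply: tmap_lin.
  + by apply: linear_comp; [apply: tmap_lin|apply: assocV1_linr].
  by move=> K y z; rewrite tmap_tgen !assocV1E !tmap_tgen !tmap_id.
- move: v; apply: tens_ext.
  + by apply: (linear_comp (assocV1_linr _)); apply: tstr_lin.
  + by apply: linear_comp; [apply: tstr_lin|apply: assocV1_linr].
  by move=> K y z; rewrite tstr_tgen !assocV1E !tstr_tgen.
Qed.

Definition tamb_assocV P Q R :
  TambMor (tamb_tens P (tamb_tens Q R)) (tamb_tens (tamb_tens P Q) R) :=
  tamb_lift (assocV_bal P Q R).

Lemma tamb_assocVE P Q R F G H K (x : P F H) (y : Q H K) (z : R K G) :
  tamb_assocV P Q R F G (tgen x (tgen y z)) = tgen (tgen x y) z.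
Proof. by rewrite (tamb_liftE (assocV_bal P Q R)) assocV1E. Qed.

(* [f (x) x |-> P(f, 1) x] and [x (x) g |-> P(1, g) x]. *)
Lemma lam_bal P : tbalanced (P := tamb_unit C) (Q := P) (R := P)
  (fun F G H (f : lhom F H) (x : P H G) => tmap f (lid G) x).
Proof.
split=> [F G|F F' G G' f g H u x|H F G K u x].
- split=> [H x|H u|H H' h u x].
  + exact: tmap_linl.
  + exact: tmap_lin.
  + by rewrite -tmap_comp /= !lcomp1l lcomp1r.
- by rewrite -!tmap_comp /= !lcomp1l !lcomp1r.
- by rewrite tstr_nat tensm_id.
Qed.

Definition tamb_lam P : TambMor (tamb_tens (tamb_unit C) P) P :=
  tamb_lift (lam_bal P).

Lemma tamb_lamE P F G H (f : lhom F H) (x : P H G) :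
  tamb_lam P F G (tgen (P := tamb_unit C) f x) = tmap f (lid G) x.
Proof. exact: (tamb_liftE (lam_bal P)). Qed.

Lemma rho_bal P : tbalanced (P := P) (Q := tamb_unit C) (R := P)
  (fun F G H (x : P F H) (g : lhom H G) => tmap (lid F) g x).
Proof.
split=> [F G|F F' G G' f g H x u|H F G K x u].
- split=> [H u|H x|H H' h x u].
  + exact: tmap_lin.
  + exact: tmap_linr.
  + by rewrite -tmap_comp /= !lcomp1l.
- by rewrite -!tmap_comp /= !lcomp1l !lcomp1r.
- by rewrite tstr_nat tensm_id.
Qed.

Definition tamb_rho P : TambMor (tamb_tens P (tamb_unit C)) P :=
  tamb_lift (rho_bal P).

Lemma tamb_rhoE P F G H (x : P F H) (g : lhom H G) :
  tamb_rho P F G (tgen (Q := tamb_unit C) x g) = tmap (lid F) g x.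
Proof. exact: (tamb_liftE (rho_bal P)). Qed.

Let tu (F G : C) (f : lhom F G) : tamb_unit C F G := f.

Lemma lamV_lin P F G :
  linear (fun x : P F G => tgen (tu (lid F)) x).
Proof. exact: tgen_linr. Qed.

Lemma lamV_nat P F F' G G' (f : lhom F' F) (g : lhom G G') (x : P F G) :
  tgen (tu (lid F')) (tmap f g x) = tmap f g (tgen (tu (lid F)) x).
Proof.
rewrite tmap_tgen.
have -> : tmap f (lid F) (tu (lid F)) = tmap (lid F') f (tu (lid F')).
  by rewrite /tu /= !lcomp1l !lcomp1r.
by rewrite tgen_dinat -tmap_comp lcomp1l lcomp1l.
Qed.

Lemma lamV_str P H F G (x : P F G) :
  tgen (tu (lid (tens H F))) (tstr H x) = tstr H (tgen (tu (lid F)) x).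
Proof. by rewrite tstr_tgen /= tensm_id. Qed.

Definition tamb_lamV P : TambMor P (tamb_tens (tamb_unit C) P) :=
  MkTambMor (@lamV_lin P) (@lamV_nat P) (@lamV_str P).

Lemma rhoV_lin P F G :
  linear (fun x : P F G => tgen x (tu (lid G))).
Proof. exact: tgen_linl. Qed.

Lemma rhoV_nat P F F' G G' (f : lhom F' F) (g : lhom G G') (x : P F G) :
  tgen (tmap f g x) (tu (lid G')) = tmap f g (tgen x (tu (lid G))).
Proof.
rewrite tmap_tgen.
have -> : tmap (lid G) g (tu (lid G)) = tmap g (lid G') (tu (lid G')).
  by rewrite /tu /= !lcomp1l !lcomp1r.
by rewrite -tgen_dinat -tmap_comp lcomp1r lcomp1r.
Qed.

Lemma rhoV_str P H F G (x : P F G) :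
  tgen (tstr H x) (tu (lid (tens H G))) = tstr H (tgen x (tu (lid G))).
Proof. by rewrite tstr_tgen /= tensm_id. Qed.

Definition tamb_rhoV P : TambMor P (tamb_tens P (tamb_unit C)) :=
  MkTambMor (@rhoV_lin P) (@rhoV_nat P) (@rhoV_str P).

Lemma tamb_lamVE P F G (x : P F G) : tamb_lamV P F G x = tgen (tu (lid F)) x.
Proof. by []. Qed.

Lemma tamb_rhoVE P F G (x : P F G) : tamb_rhoV P F G x = tgen x (tu (lid G)).
Proof. by []. Qed.

Definition tensE := (tambmor_compE, tambmor_idE, tamb_tensmE, tamb_assocE,
  tamb_assocVE, tamb_lamE, tamb_rhoE, tamb_lamVE, tamb_rhoVE).

Lemma tens_ext3 P Q R (V : lmodType k) F G
  (f g : tamb_tens (tamb_tens P Q) R F G -> V) :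
  linear f -> linear g ->
  (forall H K (x : P F H) (y : Q H K) (z : R K G),
    f (tgen (tgen x y) z) = g (tgen (tgen x y) z)) -> f =1 g.
Proof.
move=> f_lin g_lin fg; apply: tens_ext => // K u z; move: u.
apply: tens_ext => [||H x y]; last exact: fg.
- by apply: (linear_comp f_lin); apply: tgen_linl.
- by apply: (linear_comp g_lin); apply: tgen_linl.
Qed.

Lemma tens_ext3' P Q R (V : lmodType k) F G
  (f g : tamb_tens P (tamb_tens Q R) F G -> V) :
  linear f -> linear g ->
  (forall H K (x : P F H) (y : Q H K) (z : R K G),
    f (tgen x (tgen y z)) = g (tgen x (tgen y z))) -> f =1 g.
Proof.
move=> f_lin g_lin fg; apply: tens_ext => // K x u; move: u.
apply: tens_ext => [||H y z]; last exact: fg.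
- by apply: (linear_comp f_lin); apply: tgen_linr.
- by apply: (linear_comp g_lin); apply: tgen_linr.
Qed.

Lemma tambM_id P Q : tamb_tensm (tambmor_id P) (tambmor_id Q) = tambmor_id _.
Proof.
by apply: tambmor_tens_ext => F G H x y; rewrite !tensE.
Qed.

Lemma tambM_comp P P' P'' Q Q' Q'' (s' : TambMor P' P'') (s : TambMor P P')
  (t' : TambMor Q' Q'') (t : TambMor Q Q') :
  tamb_tensm (tambmor_comp s' s) (tambmor_comp t' t)
    = tambmor_comp (tamb_tensm s' t') (tamb_tensm s t).
Proof.
by apply: tambmor_tens_ext => F G H x y; rewrite !tensE.
Qed.

Lemma tambM_assocK P Q R :
  tambmor_comp (tamb_assocV P Q R) (tamb_assoc P Q R) = tambmor_id _.
Proof.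
apply: tambmor_ext => F G; apply: tens_ext3; [exact: tmor_lin..|].
by move=> H K x y z; rewrite !tensE.
Qed.

Lemma tambM_assocVK P Q R :
  tambmor_comp (tamb_assoc P Q R) (tamb_assocV P Q R) = tambmor_id _.
Proof.
apply: tambmor_ext => F G; apply: tens_ext3'; [exact: tmor_lin..|].
by move=> H K x y z; rewrite !tensE.
Qed.

Lemma tambM_lamK P : tambmor_comp (tamb_lamV P) (tamb_lam P) = tambmor_id _.
Proof.
apply: tambmor_tens_ext => F G H f x; rewrite !tensE -tgen_dinat.
by rewrite /tu /= lcomp1r lcomp1r.
Qed.

Lemma tambM_lamVK P : tambmor_comp (tamb_lam P) (tamb_lamV P) = tambmor_id _.
Proof.
by apply: tambmor_ext => F G x; rewrite !tensE tmap_id.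
Qed.

Lemma tambM_rhoK P : tambmor_comp (tamb_rhoV P) (tamb_rho P) = tambmor_id _.
Proof.
apply: tambmor_tens_ext => F G H x f; rewrite !tensE tgen_dinat.
by rewrite /tu /= lcomp1l lcomp1l.
Qed.

Lemma tambM_rhoVK P : tambmor_comp (tamb_rho P) (tamb_rhoV P) = tambmor_id _.
Proof.
by apply: tambmor_ext => F G x; rewrite !tensE tmap_id.
Qed.

Lemma tambM_assoc_nat P P' Q Q' R R' (r : TambMor P P') (s : TambMor Q Q')
  (t : TambMor R R') :
  tambmor_comp (tamb_assoc P' Q' R') (tamb_tensm (tamb_tensm r s) t)
    = tambmor_comp (tamb_tensm r (tamb_tensm s t)) (tamb_assoc P Q R).
Proof.
apply: tambmor_ext => F G; apply: tens_ext3; [exact: tmor_lin..|].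
by move=> H K x y z; rewrite !tensE.
Qed.

Lemma tambM_lam_nat P P' (s : TambMor P P') :
  tambmor_comp (tamb_lam P') (tamb_tensm (tambmor_id _) s)
    = tambmor_comp s (tamb_lam P).
Proof.
apply: tambmor_tens_ext => F G H f x.
by rewrite !tensE tmor_nat.
Qed.

Lemma tambM_rho_nat P P' (s : TambMor P P') :
  tambmor_comp (tamb_rho P') (tamb_tensm s (tambmor_id _))
    = tambmor_comp s (tamb_rho P).
Proof.
apply: tambmor_tens_ext => F G H x f.
by rewrite !tensE tmor_nat.
Qed.

Lemma tambM_pentagon P Q R S :
  tambmor_comp (tamb_assoc P Q (tamb_tens R S))
      (tamb_assoc (tamb_tens P Q) R S)
    = tambmor_comp (tambmor_comp (tamb_tensm (tambmor_id P) (tamb_assoc Q R S))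
        (tamb_assoc P (tamb_tens Q R) S))
        (tamb_tensm (tamb_assoc P Q R) (tambmor_id S)).
Proof.
apply: tambmor_ext => F G; apply: tens_ext3; [exact: tmor_lin..|].
move=> H K u y z; move: u; apply: tens_ext.
- apply: linear_comp; first exact: tmor_lin.
  by apply: (linear_comp (tgen_linl z)); apply: tgen_linl.
- apply: linear_comp; first exact: tmor_lin.
  by apply: (linear_comp (tgen_linl z)); apply: tgen_linl.
by move=> L w x; rewrite !tensE.
Qed.

Lemma tambM_triangle P Q :
  tambmor_comp (tamb_tensm (tambmor_id P) (tamb_lam Q))
      (tamb_assoc P (tamb_unit C) Q)
    = tamb_tensm (tamb_rho P) (tambmor_id Q).
Proof.
apply: tambmor_ext => F G; apply: tens_ext3; [exact: tmor_lin..|].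
move=> H K x f y; by rewrite !tensE tgen_dinat.
Qed.

Definition TambMon : MonCat :=
  @MkMonCat TambCat (@tamb_tens k C) tamb_tensm (tamb_unit C)
    tamb_assoc tamb_assocV tamb_lam tamb_lamV tamb_rho tamb_rhoV
    tambM_id tambM_comp tambM_assocK tambM_assocVK tambM_lamK tambM_lamVK
    tambM_rhoK tambM_rhoVK tambM_assoc_nat tambM_lam_nat tambM_rho_nat
    tambM_pentagon tambM_triangle.

End TambMon.

Record EnrCat (V : MonCat) : Type := MkEnrCat {
  eob :> Type;
  ehom : eob -> eob -> V;
  eid : forall X, chom vunit (ehom X X);
  ecomp : forall X Y Z, chom (vtens (ehom Y Z) (ehom X Y)) (ehom X Z);
  ecompA : forall W X Y Z,
    ecomp W X Z \v vtensm (ecomp X Y Z) (catid (ehom W X))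
      = ecomp W Y Z \v vtensm (catid (ehom Y Z)) (ecomp W X Y)
          \v vassoc (ehom Y Z) (ehom X Y) (ehom W X);
  ecomp1l : forall X Y,
    ecomp X Y Y \v vtensm (eid Y) (catid (ehom X Y)) = vlam (ehom X Y);
  ecomp1r : forall X Y,
    ecomp X X Y \v vtensm (catid (ehom X Y)) (eid X) = vrho (ehom X Y)
}.

Arguments ehom {V e} X Y : rename.
Arguments eid {V e} X : rename.
Arguments ecomp {V e} X Y Z : rename.

Record EnrFun (V : MonCat) (A B : EnrCat V) : Type := MkEnrFun {
  efob :> A -> B;
  efmor : forall X Y : A, chom (ehom X Y) (ehom (efob X) (efob Y));
  efmor_id : forall X : A, efmor X X \v eid X = eid (efob X);
  efmor_comp : forall X Y Z : A,
    efmor X Z \v ecomp X Y Z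
      = ecomp (efob X) (efob Y) (efob Z) \v vtensm (efmor Y Z) (efmor X Y)
}.

Record EnrNat (V : MonCat) (A B : EnrCat V) (F G : EnrFun A B) : Type :=
  MkEnrNat {
  ecmp :> forall X : A, chom vunit (ehom (F X) (G X));
  ecmp_nat : forall X Y : A,
    ecomp (F X) (F Y) (G Y) \v vtensm (ecmp Y) (efmor F X Y)
        \v vlamV (ehom X Y)
      = ecomp (F X) (G X) (G Y) \v vtensm (efmor G X Y) (ecmp X)
          \v vrhoV (ehom X Y)
}.

Section Elements.
Variables (V : MonCat) (E : EnrCat V).

Definition epost (X Y Z : E) (a : chom vunit (ehom Y Z)) :
    chom (ehom X Y) (ehom X Z) :=
  ecomp X Y Z \v vtensm a (catid (ehom X Y)) \v vlamV (ehom X Y).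

Definition epre (X Y Z : E) (a : chom vunit (ehom X Y)) :
    chom (ehom Y Z) (ehom X Z) :=
  ecomp X Y Z \v vtensm (catid (ehom Y Z)) a \v vrhoV (ehom Y Z).

Definition emul (X Y Z : E) (b : chom vunit (ehom Y Z))
    (a : chom vunit (ehom X Y)) : chom vunit (ehom X Z) :=
  ecomp X Y Z \v vtensm b a \v vlamV vunit.

Lemma epost_elt (X Y Z : E) (b : chom vunit (ehom Y Z))
  (a : chom vunit (ehom X Y)) : epost X b \v a = emul b a.
Proof.
by rewrite /epost /emul -ccompA vlamV_nat ccompA -[_ \v vtensm b _ \v _]ccompA
  -vtensm_comp ccomp1r ccomp1l.
Qed.

Lemma epre_elt (X Y Z : E) (b : chom vunit (ehom Y Z))
  (a : chom vunit (ehom X Y)) : epre Z a \v b = emul b a.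
Proof.
by rewrite /epre /emul -ccompA vrhoV_nat ccompA -[_ \v vtensm _ a \v _]ccompA
  -vtensm_comp ccomp1r ccomp1l vlamV_rhoV.
Qed.

Lemma epost_id (X Y : E) : epost X (eid Y) = catid (ehom X Y).
Proof. by rewrite /epost ecomp1l vlamVK. Qed.

Lemma epre_id (X Y : E) : epre Y (eid X) = catid (ehom X Y).
Proof. by rewrite /epre ecomp1r vrhoVK. Qed.

Lemma ecompA' (W X Y Z : E) :
  ecomp W Y Z \v vtensm (catid (ehom Y Z)) (ecomp W X Y)
    = ecomp W X Z \v vtensm (ecomp X Y Z) (catid (ehom W X))
        \v vassocV (ehom Y Z) (ehom X Y) (ehom W X).
Proof. by rewrite ecompA -!ccompA vassocVK ccomp1r. Qed.

Lemma epost_post (W X Y Z : E) (b : chom vunit (ehom Y Z))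
  (a : chom vunit (ehom X Y)) :
  epost W b \v epost W a = epost W (emul b a).
Proof.
rewrite {1}/epost -ccompA vlamV_nat ccompA -[_ \v vtensm b _ \v _]ccompA.
rewrite -vtensm_comp ccomp1r ccomp1l {1}/epost.
have -> : vtensm b (ecomp W X Y \v vtensm a (catid _) \v vlamV (ehom W X))
  = vtensm (catid _) (ecomp W X Y) \v (vtensm b (vtensm a (catid _)))
    \v vtensm (catid _) (vlamV (ehom W X)).
  by rewrite -!vtensm_comp !ccomp1l ccomp1r.
rewrite !ccompA ecompA' -[_ \v vassocV _ _ _ \v _]ccompA vassocV_nat.
rewrite !ccompA -[_ \v vassocV _ _ _ \v _]ccompA vtriangleV.
rewrite /epost /emul -[_ \v vtensm _ _ \v vtensm (vtensm _ _) _]ccompA.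
rewrite -vtensm_comp -[_ \v vtensm _ _ \v vtensm (vrhoV _) _]ccompA.
by rewrite -vtensm_comp !ccomp1l vlamV_rhoV.
Qed.

Lemma epost_pre (W X Y Z : E) (b : chom vunit (ehom Y Z))
  (a : chom vunit (ehom W X)) :
  epost W b \v epre Y a = epre Z a \v epost X b.
Proof.
set r := (X in _ = X); rewrite [epost W b]/epost -ccompA vlamV_nat ccompA -[_ \v vtensm b _ \v _]ccompA.
rewrite -vtensm_comp ccomp1r ccomp1l [epre Y a]/epre.
have -> : vtensm b (ecomp W X Y \v vtensm (catid _) a \v vrhoV (ehom X Y))
  = vtensm (catid _) (ecomp W X Y) \v (vtensm b (vtensm (catid _) a))
    \v vtensm (catid _) (vrhoV (ehom X Y)).
  by rewrite -!vtensm_comp !ccomp1l ccomp1r.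
rewrite !ccompA ecompA' -[_ \v vassocV _ _ _ \v _]ccompA vassocV_nat.
rewrite !ccompA -[_ \v vassocV _ _ _ \v _]ccompA vrhoV_tens.
rewrite {}/r [epre Z a]/epre -[in RHS]ccompA vrhoV_nat ccompA.
rewrite -[in RHS](ccompA _ _ (vtensm _ _)) -vtensm_comp ccomp1l ccomp1r.
rewrite /epost.
have -> : vtensm (ecomp X Y Z \v vtensm b (catid _) \v vlamV (ehom X Y)) a
  = vtensm (ecomp X Y Z) (catid _) \v (vtensm (vtensm b (catid _)) a)
    \v vtensm (vlamV (ehom X Y)) (catid _).
  by rewrite -!vtensm_comp !ccomp1l ccomp1r.
by rewrite -!ccompA vrhoV_nat.
Qed.

End Elements.

Section EnrOp.
Variables (V : MonCat) (E : EnrCat V).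

(* Exchanges [epost] and [epre]. *)
Definition enr_op : EnrCat (mon_rev V) :=
  @MkEnrCat (mon_rev V) E (fun X Y => ehom Y X) (fun X => eid X)
    (fun X Y Z => ecomp Z Y X)
    (fun W X Y Z => ecompA' Z Y X W)
    (fun X Y => ecomp1r Y X) (fun X Y => ecomp1l Y X).

Lemma epre_pre (X Y Z W : E) (b : chom vunit (ehom Y Z))
  (a : chom vunit (ehom X Y)) :
  epre W a \v epre W b = epre W (emul b a).
Proof.
have e : @emul _ enr_op Z Y X a b = emul b a by rewrite /emul /= vlamV_rhoV.
by have := @epost_post _ enr_op W Z Y X a b; rewrite e.
Qed.

Lemma emulA (W X Y Z : E) (c : chom vunit (ehom Y Z))
  (b : chom vunit (ehom X Y)) (a : chom vunit (ehom W X)) :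
  emul c (emul b a) = emul (emul c b) a.
Proof.
by rewrite -(epost_elt c) -(epost_elt b) ccompA epost_post epost_elt.
Qed.

Lemma emul1l (X Y : E) (a : chom vunit (ehom X Y)) : emul (eid Y) a = a.
Proof. by rewrite -epost_elt epost_id ccomp1l. Qed.

Lemma emul1r (X Y : E) (a : chom vunit (ehom X Y)) : emul a (eid X) = a.
Proof. by rewrite -epre_elt epre_id ccomp1l. Qed.

End EnrOp.

Section EnrFunFacts.
Variables (V : MonCat).

Section One.
Variables (A B : EnrCat V) (F : EnrFun A B).

Lemma efmor_post (X Y Z : A) (a : chom vunit (ehom Y Z)) :
  efmor F X Z \v epost X a = epost (F X) (efmor F Y Z \v a) \v efmor F X Y.
Proof.
rewrite /epost -[in RHS]ccompA vlamV_nat !ccompA efmor_comp.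
rewrite -[_ \v vtensm _ _ \v vtensm a _]ccompA -vtensm_comp.
rewrite -[in RHS](ccompA _ _ (vtensm _ _)) -vtensm_comp.
by rewrite !ccomp1l !ccomp1r.
Qed.

Lemma efmor_pre (X Y Z : A) (a : chom vunit (ehom X Y)) :
  efmor F X Z \v epre Z a = epre (F Z) (efmor F X Y \v a) \v efmor F Y Z.
Proof.
rewrite /epre -[in RHS]ccompA vrhoV_nat !ccompA efmor_comp.
rewrite -[_ \v vtensm _ _ \v vtensm _ a]ccompA -vtensm_comp.
rewrite -[in RHS](ccompA _ _ (vtensm _ _)) -vtensm_comp.
by rewrite !ccomp1l !ccomp1r.
Qed.

Lemma efmor_mul (X Y Z : A) (b : chom vunit (ehom Y Z))
  (a : chom vunit (ehom X Y)) :
  efmor F X Z \v emul b a = emul (efmor F Y Z \v b) (efmor F X Y \v a).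
Proof. by rewrite -!epost_elt ccompA efmor_post ccompA. Qed.

End One.

Variables (A B : EnrCat V).

Lemma enat_nat (F G : EnrFun A B) (t : EnrNat F G) (X Y : A) :
  epost (F X) (t Y) \v efmor F X Y = epre (G Y) (t X) \v efmor G X Y.
Proof.
rewrite /epost /epre -ccompA vlamV_nat -[in RHS]ccompA vrhoV_nat !ccompA.
rewrite -[_ \v vtensm (t Y) _ \v _]ccompA -vtensm_comp.
rewrite -[in RHS](ccompA _ _ (vtensm _ _)) -vtensm_comp.
by rewrite !ccomp1l !ccomp1r ecmp_nat.
Qed.

Lemma enat_intro (F G : EnrFun A B)
  (t : forall X : A, chom vunit (ehom (F X) (G X))) :
  (forall X Y, epost (F X) (t Y) \v efmor F X Y
     = epre (G Y) (t X) \v efmor G X Y) ->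
  forall X Y : A,
    ecomp (F X) (F Y) (G Y) \v vtensm (t Y) (efmor F X Y)
        \v vlamV (ehom X Y)
      = ecomp (F X) (G X) (G Y) \v vtensm (efmor G X Y) (t X)
          \v vrhoV (ehom X Y).
Proof.
move=> t_nat X Y; have := t_nat X Y.
rewrite /epost /epre -ccompA vlamV_nat -[in RHS]ccompA vrhoV_nat !ccompA.
rewrite -[_ \v vtensm (t Y) _ \v _]ccompA -vtensm_comp.
rewrite -[in RHS](ccompA _ _ (vtensm _ _)) -vtensm_comp.
by rewrite !ccomp1l !ccomp1r.
Qed.

Lemma enat_ext (F G : EnrFun A B) (s t : EnrNat F G) :
  (forall X, s X = t X) -> s = t.
Proof.
case: s t => [s s_nat] [t t_nat] /= st.
have e : s = t by exact: functional_extensionality_dep.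
by case: _ / e t_nat {st} => t_nat; congr MkEnrNat; apply: Prop_irrelevance.
Qed.

Lemma enrfun_ext (o : A -> B)
  (m m' : forall X Y : A, chom (ehom X Y) (ehom (o X) (o Y))) i i' c c' :
  (forall X Y, m X Y = m' X Y) ->
  @MkEnrFun V A B o m i c = @MkEnrFun V A B o m' i' c'.
Proof.
move=> mm'; have e : m = m'.
  by do 2![apply: functional_extensionality_dep => ?].
by case: _ / e i' c' => i' c'; congr MkEnrFun; apply: Prop_irrelevance.
Qed.

Lemma enat_id_nat (F : EnrFun A B) (X Y : A) :
  epost (F X) (eid (F Y)) \v efmor F X Y = epre (F Y) (eid (F X)) \v efmor F X Y.
Proof. by rewrite epost_id epre_id. Qed.

Definition enat_id (F : EnrFun A B) : EnrNat F F :=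
  MkEnrNat (enat_intro (enat_id_nat F)).

Lemma enat_comp_nat (F G H : EnrFun A B) (t : EnrNat G H) (s : EnrNat F G)
  (X Y : A) :
  epost (F X) (emul (t Y) (s Y)) \v efmor F X Y
    = epre (H Y) (emul (t X) (s X)) \v efmor H X Y.
Proof.
rewrite -epost_post -ccompA enat_nat ccompA epost_pre -ccompA enat_nat.
by rewrite ccompA epre_pre.
Qed.

Definition enat_comp (F G H : EnrFun A B) (t : EnrNat G H) (s : EnrNat F G) :
  EnrNat F H := MkEnrNat (enat_intro (enat_comp_nat t s)).

Lemma enat_compA (F G H K : EnrFun A B) (u : EnrNat H K) (t : EnrNat G H)
  (s : EnrNat F G) :
  enat_comp u (enat_comp t s) = enat_comp (enat_comp u t) s.
Proof. by apply: enat_ext => X; apply: emulA. Qed.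

Lemma enat_comp1l (F G : EnrFun A B) (t : EnrNat F G) :
  enat_comp (enat_id G) t = t.
Proof. by apply: enat_ext => X; apply: emul1l. Qed.

Lemma enat_comp1r (F G : EnrFun A B) (t : EnrNat F G) :
  enat_comp t (enat_id F) = t.
Proof. by apply: enat_ext => X; apply: emul1r. Qed.

Definition enr_hom : Cat := MkCat enat_compA enat_comp1l enat_comp1r.

Lemma cidto_enr (F G : enr_hom) (e : F = G) (X : A) (eX : efob F X = efob G X) :
  (cidto e : EnrNat F G) X
    = eq_rect (efob F X) (fun Z => chom vunit (ehom (efob F X) Z))
        (eid (efob F X)) (efob G X) eX.
Proof.
by case: _ / e eX => eX; rewrite (Prop_irrelevance eX erefl).
Qed.

End EnrFunFacts.

#[local] Opaque epost epre emul.

Section EnrTwo.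
Variable V : MonCat.
Implicit Types A B D E : EnrCat V.

Lemma enrfun_id_id A (X : A) : catid (ehom X X) \v eid X = eid X.
Proof. by rewrite ccomp1l. Qed.

Lemma enrfun_id_comp A (X Y Z : A) :
  catid (ehom X Z) \v ecomp X Y Z
    = ecomp X Y Z \v vtensm (catid (ehom Y Z)) (catid (ehom X Y)).
Proof. by rewrite vtensm_id ccomp1l ccomp1r. Qed.

Definition enrfun_id A : EnrFun A A :=
  @MkEnrFun V A A id (fun X Y => catid (ehom X Y)) (@enrfun_id_id A)
    (@enrfun_id_comp A).

Lemma enrfun_comp_id A B D (G : EnrFun B D) (F : EnrFun A B) (X : A) :
  efmor G (F X) (F X) \v efmor F X X \v eid X = eid (G (F X)).
Proof. by rewrite -ccompA !efmor_id. Qed.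

Lemma enrfun_comp_comp A B D (G : EnrFun B D) (F : EnrFun A B) (X Y Z : A) :
  efmor G (F X) (F Z) \v efmor F X Z \v ecomp X Y Z
    = ecomp (G (F X)) (G (F Y)) (G (F Z))
        \v vtensm (efmor G (F Y) (F Z) \v efmor F Y Z)
             (efmor G (F X) (F Y) \v efmor F X Y).
Proof. by rewrite vtensm_comp -ccompA efmor_comp !ccompA efmor_comp. Qed.

Definition enrfun_comp A B D (G : EnrFun B D) (F : EnrFun A B) : EnrFun A D :=
  @MkEnrFun V A D (fun X => G (F X))
    (fun X Y => efmor G (F X) (F Y) \v efmor F X Y)
    (enrfun_comp_id G F) (enrfun_comp_comp G F).

Lemma enat_hcomp_nat A B D (G G' : EnrFun B D) (F F' : EnrFun A B)
  (t : EnrNat G G') (s : EnrNat F F') (X Y : A) :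
  let r Z := emul (t (F' Z)) (efmor G (F Z) (F' Z) \v s Z) in
  epost (G (F X)) (r Y) \v (efmor G (F X) (F Y) \v efmor F X Y)
    = epre (G' (F' Y)) (r X) \v (efmor G' (F' X) (F' Y) \v efmor F' X Y).
Proof.
have e : epost (G (F X)) (efmor G (F Y) (F' Y) \v s Y)
    \v (efmor G (F X) (F Y) \v efmor F X Y)
  = epre (G (F' Y)) (efmor G (F X) (F' X) \v s X)
    \v (efmor G (F' X) (F' Y) \v efmor F' X Y).
  by rewrite ccompA -efmor_post -ccompA enat_nat ccompA efmor_pre -ccompA.
rewrite /= -epost_post -ccompA e ccompA epost_pre -ccompA.
rewrite [epost _ _ \v (_ \v _)]ccompA enat_nat -epre_pre.
by rewrite -!ccompA.
Qed.

(* Horizontal composite, with components [t_{F'X} . G(s_X)]. *)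
Definition enat_hcomp A B D (G G' : EnrFun B D) (F F' : EnrFun A B)
    (t : EnrNat G G') (s : EnrNat F F') :
    EnrNat (enrfun_comp G F) (enrfun_comp G' F') :=
  @MkEnrNat V A D (enrfun_comp G F) (enrfun_comp G' F')
    (fun X => emul (t (F' X)) (efmor G (F X) (F' X) \v s X))
    (@enat_intro V A D (enrfun_comp G F) (enrfun_comp G' F') _
      (enat_hcomp_nat t s)).

Lemma enr_hcomp_id A B D (G : EnrFun B D) (F : EnrFun A B) :
  enat_hcomp (enat_id G) (enat_id F) = enat_id (enrfun_comp G F).
Proof. by apply: enat_ext => X; rewrite /= efmor_id emul1l. Qed.

Lemma enat_nat_elt A B (F G : EnrFun A B) (t : EnrNat F G) (X Y : A)
  (a : chom vunit (ehom X Y)) :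
  emul (t Y) (efmor F X Y \v a) = emul (efmor G X Y \v a) (t X).
Proof. by rewrite -epost_elt ccompA enat_nat -ccompA epre_elt. Qed.

Lemma enr_hcomp_comp A B D (G G' G'' : EnrFun B D) (F F' F'' : EnrFun A B)
  (t' : EnrNat G' G'') (t : EnrNat G G') (s' : EnrNat F' F'')
  (s : EnrNat F F') :
  enat_hcomp (enat_comp t' t) (enat_comp s' s)
    = enat_comp (enat_hcomp t' s') (enat_hcomp t s).
Proof.
apply: enat_ext => X /=; rewrite efmor_mul !emulA; congr (emul _ _).
by rewrite -!emulA; congr (emul _ _); rewrite enat_nat_elt.
Qed.

Lemma enr_comp1A A B D E (H : EnrFun D E) (G : EnrFun B D) (F : EnrFun A B) :
  enrfun_comp H (enrfun_comp G F) = enrfun_comp (enrfun_comp H G) F.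
Proof. by apply: enrfun_ext => X Y; apply: ccompA. Qed.

Lemma enr_comp1l A B (F : EnrFun A B) : enrfun_comp (enrfun_id B) F = F.
Proof. by case: F => o m i c; apply: enrfun_ext => X Y; apply: ccomp1l. Qed.

Lemma enr_comp1r A B (F : EnrFun A B) : enrfun_comp F (enrfun_id A) = F.
Proof. by case: F => o m i c; apply: enrfun_ext => X Y; apply: ccomp1r. Qed.

Lemma enr_hcompA A B D E (H H' : enr_hom D E) (G G' : enr_hom B D)
  (F F' : enr_hom A B) (u : chom H H') (t : chom G G') (s : chom F F') :
  (@cidto (enr_hom A E) _ _ (enr_comp1A H' G' F'))
      \v (enat_hcomp u (enat_hcomp t s) : @chom (enr_hom A E) _ _)
    = (enat_hcomp (enat_hcomp u t) s : @chom (enr_hom A E) _ _)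
      \v @cidto (enr_hom A E) _ _ (enr_comp1A H G F).
Proof.
apply: enat_ext => X /=.
rewrite (@cidto_enr _ _ _ _ _ (enr_comp1A H' G' F') X erefl).
rewrite (@cidto_enr _ _ _ _ _ (enr_comp1A H G F) X erefl) /=.
by rewrite emul1l emul1r efmor_mul emulA !ccompA.
Qed.

Lemma enr_hcomp1l A B (F F' : enr_hom A B) (s : chom F F') :
  @cidto (enr_hom A B) _ _ (enr_comp1l F')
      \v (enat_hcomp (enat_id (enrfun_id B)) s : @chom (enr_hom A B) _ _)
    = s \v @cidto (enr_hom A B) _ _ (enr_comp1l F).
Proof.
apply: enat_ext => X /=.
rewrite (@cidto_enr _ _ _ _ _ (enr_comp1l F') X erefl).
rewrite (@cidto_enr _ _ _ _ _ (enr_comp1l F) X erefl) /=.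
by rewrite !emul1l emul1r ccomp1l.
Qed.

Lemma enr_hcomp1r A B (F F' : enr_hom A B) (s : chom F F') :
  @cidto (enr_hom A B) _ _ (enr_comp1r F')
      \v (enat_hcomp s (enat_id (enrfun_id A)) : @chom (enr_hom A B) _ _)
    = s \v @cidto (enr_hom A B) _ _ (enr_comp1r F).
Proof.
apply: enat_ext => X /=.
rewrite (@cidto_enr _ _ _ _ _ (enr_comp1r F') X erefl).
rewrite (@cidto_enr _ _ _ _ _ (enr_comp1r F) X erefl) /=.
by rewrite efmor_id !emul1r emul1l.
Qed.

Definition EnrTwoCat : TwoCat :=
  @MkTwoCat (EnrCat V) (@enr_hom V) enrfun_id enrfun_comp enat_hcomp
    enr_hcomp_id enr_hcomp_comp enr_comp1A enr_comp1l enr_comp1r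
    enr_hcompA enr_hcomp1l enr_hcomp1r.

End EnrTwo.

Section CMod.
Variables (k : fieldType) (C : StrictMonCat k).
Implicit Types M N P Q : ModCat C.

Lemma mphiV_nat M N (Phi : ModFun M N) F X Y (u : lhom X Y) :
  mphiV Phi F Y \c fmor Phi (fmor (act M F) u)
    = fmor (act N F) (fmor Phi u) \c mphiV Phi F X.
Proof.
rewrite -[LHS]lcomp1r -(mphiVK Phi F X) lcompA -[_ \c mphi Phi F X]lcompA.
by rewrite -mphi_nat lcompA mphiK lcomp1l.
Qed.

Lemma mphiV_natl M N (Phi : ModFun M N) F G (f : lhom F G) X :
  mphiV Phi G X \c fmor Phi (actm M f X) = actm N f (Phi X) \c mphiV Phi F X.
Proof.
rewrite -[LHS]lcomp1r -(mphiVK Phi F X) lcompA -[_ \c mphi Phi F X]lcompA.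
by rewrite -mphi_natl lcompA mphiK lcomp1l.
Qed.

Lemma modfun_ext M N (o : M -> N)
  (m : forall X Y : M, lhom X Y -> lhom (o X) (o Y)) l l' i i' c c' :
  let L := @MkLinFun k M N o m l i c in
  let L' := @MkLinFun k M N o m l' i' c' in
  forall p q a1 a2 a3 a4 a5 a6 p' q' b1 b2 b3 b4 b5 b6,
  (forall F X, p F X = p' F X) ->
  @MkModFun k C M N L p q a1 a2 a3 a4 a5 a6
    = @MkModFun k C M N L' p' q' b1 b2 b3 b4 b5 b6.
Proof.
move=> /=; rewrite (Prop_irrelevance l' l) (Prop_irrelevance i' i).
rewrite (Prop_irrelevance c' c) => p q a1 a2 a3 a4 a5 a6 p' q'.
move=> b1 b2 b3 b4 b5 b6 pp'.
have e : p = p' by do 2![apply: functional_extensionality_dep => ?].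
case: _ / e b1 b2 b3 b4 b5 b6 {pp'} => b1 b2 b3 b4 b5 b6.
have e : q = q'.
  do 2![apply: functional_extensionality_dep => ?].
  by rewrite -[LHS]lcomp1r -b2 lcompA a1 lcomp1l.
case: _ / e b1 b2 b3 b4 b5 b6 => *.
by congr MkModFun; apply: Prop_irrelevance.
Qed.

Section ModFunId.
Variable M : ModCat C.
Let I := linfun_id M.
Let p (F : C) (X : M) : lhom (act M F (I X)) (I (act M F X)) := lid _.

Definition modfun_id : ModFun M M.
Proof.
refine (@MkModFun k C M M I p p _ _ _ _ _ _); rewrite /p.
- by move=> F X; rewrite lcomp1l.
- by move=> F X; rewrite lcomp1l.
- by move=> F X Y u; rewrite lcomp1l lcomp1r.
- by move=> F G f X; rewrite lcomp1l lcomp1r.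
- by move=> X; rewrite lcomp1r.
- by move=> F G X; rewrite lcomp1r fmor_id !lcomp1l.
Defined.

End ModFunId.

Section ModFunComp.
Variables (M N P : ModCat C) (Psi : ModFun N P) (Phi : ModFun M N).
Let L := linfun_comp Psi Phi.

Let p (F : C) (X : M) : lhom (act P F (L X)) (L (act M F X)) :=
  fmor Psi (mphi Phi F X) \c mphi Psi F (Phi X).

Let q (F : C) (X : M) : lhom (L (act M F X)) (act P F (L X)) :=
  mphiV Psi F (Phi X) \c fmor Psi (mphiV Phi F X).

(* The coherence isomorphism is [Psi(phi) . psi_Phi]. *)
Definition modfun_comp : ModFun M P.
Proof.
refine (@MkModFun k C M P L p q _ _ _ _ _ _); rewrite /p /q /=.
- move=> F X; rewrite lcompA -[_ \c fmor Psi (mphi _ _ _)]lcompA -(fmor_comp Psi).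
  by rewrite mphiK fmor_id lcomp1r mphiK.
- move=> F X; rewrite lcompA -[_ \c mphiV Psi _ _]lcompA mphiVK lcomp1r.
  by rewrite -(fmor_comp Psi) mphiVK fmor_id.
- move=> F X Y u /=; rewrite -lcompA mphi_nat !lcompA -!(fmor_comp Psi).
  by rewrite mphi_nat.
- move=> F G f X /=; rewrite -lcompA mphi_natl !lcompA -!(fmor_comp Psi).
  by rewrite mphi_natl.
- by move=> X /=; rewrite lcompA -(fmor_comp Psi) mphi_one mphi_one.
- move=> F G X /=; rewrite lcompA -(fmor_comp Psi) mphi_tens.
  rewrite !(fmor_comp Psi) (fmor_comp (act P F)) -!lcompA mphi_tens.
  by congr (_ \c _); rewrite !lcompA mphi_nat.
Defined.

End ModFunComp.

Lemma modnat_ext M N (Phi Phi' : ModFun M N) (s t : ModNat Phi Phi') :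
  (forall X, mnat s X = mnat t X) -> s = t.
Proof.
case: s t => [[s s1] s2] [[t t1] t2] /= st.
have e : s = t by exact: functional_extensionality_dep.
case: _ / e t1 t2 {st} => t1; rewrite (Prop_irrelevance t1 s1) => t2.
by congr MkModNat; apply: Prop_irrelevance.
Qed.

Section ModNatId.
Variables (M N : ModCat C) (Phi : ModFun M N).

Lemma modnat_id_nat (X Y : M) (f : lhom X Y) :
  lid (Phi Y) \c fmor Phi f = fmor Phi f \c lid (Phi X).
Proof. by rewrite lcomp1l lcomp1r. Qed.

Let n : LinNat Phi Phi := MkLinNat modnat_id_nat.

Lemma modnat_id_phi (F : C) (X : M) :
  n (act M F X) \c mphi Phi F X = mphi Phi F X \c fmor (act N F) (n X).
Proof. by rewrite /= lcomp1l fmor_id lcomp1r. Qed.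

Definition modnat_id : ModNat Phi Phi := MkModNat modnat_id_phi.

End ModNatId.

Section ModNatComp.
Variables (M N : ModCat C) (Phi Phi' Phi'' : ModFun M N).
Variables (t : ModNat Phi' Phi'') (s : ModNat Phi Phi').

Lemma modnat_comp_nat (X Y : M) (f : lhom X Y) :
  mnat t Y \c mnat s Y \c fmor Phi f
    = fmor Phi'' f \c (mnat t X \c mnat s X).
Proof. by rewrite -lcompA nnat lcompA nnat lcompA. Qed.

Let n : LinNat Phi Phi'' :=
  @MkLinNat k M N Phi Phi'' (fun X => mnat t X \c mnat s X) modnat_comp_nat.

Lemma modnat_comp_phi (F : C) (X : M) :
  n (act M F X) \c mphi Phi F X = mphi Phi'' F X \c fmor (act N F) (n X).
Proof.
by rewrite /= -lcompA mnat_phi lcompA mnat_phi fmor_comp lcompA.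
Qed.

Definition modnat_comp : ModNat Phi Phi'' := MkModNat modnat_comp_phi.

End ModNatComp.

Section ModNatHcomp.
Variables (M N P : ModCat C) (Psi Psi' : ModFun N P) (Phi Phi' : ModFun M N).
Variables (t : ModNat Psi Psi') (s : ModNat Phi Phi').

Lemma modnat_hcomp_nat (X Y : M) (f : lhom X Y) :
  mnat t (Phi' Y) \c fmor Psi (mnat s Y) \c fmor (modfun_comp Psi Phi) f
    = fmor (modfun_comp Psi' Phi') f
        \c (mnat t (Phi' X) \c fmor Psi (mnat s X)).
Proof.
rewrite /= -lcompA -(fmor_comp Psi) (nnat (mnat s)) (fmor_comp Psi) lcompA.
rewrite (nnat (mnat t)).
by rewrite lcompA.
Qed.

Let n : LinNat (modfun_comp Psi Phi) (modfun_comp Psi' Phi') :=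
  @MkLinNat k M P (modfun_comp Psi Phi) (modfun_comp Psi' Phi')
    (fun X => mnat t (Phi' X) \c fmor Psi (mnat s X)) modnat_hcomp_nat.

Lemma modnat_hcomp_phi (F : C) (X : M) :
  n (act M F X) \c mphi (modfun_comp Psi Phi) F X
    = mphi (modfun_comp Psi' Phi') F X \c fmor (act P F) (n X).
Proof.
rewrite /= lcompA -[_ \c fmor Psi (mphi _ _ _)]lcompA -(fmor_comp Psi).
rewrite mnat_phi (fmor_comp Psi) !lcompA nnat -!lcompA; congr (_ \c _).
by rewrite -mphi_nat lcompA mnat_phi (fmor_comp (act P F)) !lcompA.
Qed.

(* Horizontal composite, with components [t_{Phi'X} . Psi(s_X)]. *)
Definition modnat_hcomp :
  ModNat (modfun_comp Psi Phi) (modfun_comp Psi' Phi') :=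
  MkModNat modnat_hcomp_phi.

End ModNatHcomp.

Lemma modnat_compA M N (F G H K : ModFun M N) (u : ModNat H K)
  (t : ModNat G H) (s : ModNat F G) :
  modnat_comp u (modnat_comp t s) = modnat_comp (modnat_comp u t) s.
Proof. by apply: modnat_ext => X; apply: lcompA. Qed.

Lemma modnat_comp1l M N (F G : ModFun M N) (t : ModNat F G) :
  modnat_comp (modnat_id G) t = t.
Proof. by apply: modnat_ext => X; apply: lcomp1l. Qed.

Lemma modnat_comp1r M N (F G : ModFun M N) (t : ModNat F G) :
  modnat_comp t (modnat_id F) = t.
Proof. by apply: modnat_ext => X; apply: lcomp1r. Qed.

Definition mod_hom M N : Cat :=
  @MkCat (ModFun M N) (@ModNat k C M N) (@modnat_id M N) (@modnat_comp M N)
    (@modnat_compA M N) (@modnat_comp1l M N) (@modnat_comp1r M N).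

Lemma cidto_mod M N (F G : ModFun M N) (e : F = G) (X : M)
  (eX : mfun F X = mfun G X) :
  mnat (@cidto (mod_hom M N) _ _ e) X = idto eX.
Proof. by case: _ / e eX => eX; rewrite idto1. Qed.

Lemma mod_hcomp_id M N P (G : ModFun N P) (F : ModFun M N) :
  modnat_hcomp (modnat_id G) (modnat_id F) = modnat_id (modfun_comp G F).
Proof. by apply: modnat_ext => X /=; rewrite fmor_id lcomp1l. Qed.

Lemma mod_hcomp_comp M N P (G G' G'' : ModFun N P) (F F' F'' : ModFun M N)
  (t' : ModNat G' G'') (t : ModNat G G') (s' : ModNat F' F'')
  (s : ModNat F F') :
  modnat_hcomp (modnat_comp t' t) (modnat_comp s' s)
    = modnat_comp (modnat_hcomp t' s') (modnat_hcomp t s).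
Proof.
apply: modnat_ext => X /=; rewrite fmor_comp !lcompA; congr (_ \c _).
by rewrite -!lcompA nnat.
Qed.

Lemma mod_comp1A M N P Q (H : ModFun P Q) (G : ModFun N P) (F : ModFun M N) :
  modfun_comp H (modfun_comp G F) = modfun_comp (modfun_comp H G) F.
Proof.
by apply: modfun_ext => A X /=; rewrite fmor_comp lcompA.
Qed.

Lemma mod_comp1l M N (F : ModFun M N) : modfun_comp (modfun_id N) F = F.
Proof.
by case: F => [[o m l i c] p q *]; apply: modfun_ext => A X /=; rewrite lcomp1r.
Qed.

Lemma mod_comp1r M N (F : ModFun M N) : modfun_comp F (modfun_id M) = F.
Proof.
case: F => [[o m l i c] p q *]; apply: modfun_ext => A X /=.
by rewrite i lcomp1l.
Qed.

Lemma mod_hcompA M N P Q (H H' : mod_hom P Q) (G G' : mod_hom N P)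
  (F F' : mod_hom M N) (u : chom H H') (t : chom G G') (s : chom F F') :
  @cidto (mod_hom M Q) _ _ (mod_comp1A H' G' F')
      \v (modnat_hcomp u (modnat_hcomp t s) : @chom (mod_hom M Q) _ _)
    = (modnat_hcomp (modnat_hcomp u t) s : @chom (mod_hom M Q) _ _)
      \v @cidto (mod_hom M Q) _ _ (mod_comp1A H G F).
Proof.
apply: modnat_ext => X; rewrite [LHS]/= [RHS]/=.
rewrite (@cidto_mod _ _ _ _ (mod_comp1A H' G' F') X erefl).
rewrite (@cidto_mod _ _ _ _ (mod_comp1A H G F) X erefl) /=.
by rewrite lcomp1l lcomp1r fmor_comp lcompA.
Qed.

Lemma mod_hcomp1l M N (F F' : mod_hom M N) (s : chom F F') :
  @cidto (mod_hom M N) _ _ (mod_comp1l F')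
      \v (modnat_hcomp (modnat_id (modfun_id N)) s : @chom (mod_hom M N) _ _)
    = s \v @cidto (mod_hom M N) _ _ (mod_comp1l F).
Proof.
apply: modnat_ext => X; rewrite [LHS]/= [RHS]/=.
rewrite (@cidto_mod _ _ _ _ (mod_comp1l F') X erefl).
rewrite (@cidto_mod _ _ _ _ (mod_comp1l F) X erefl) /=.
by rewrite !lcomp1l lcomp1r.
Qed.

Lemma mod_hcomp1r M N (F F' : mod_hom M N) (s : chom F F') :
  @cidto (mod_hom M N) _ _ (mod_comp1r F')
      \v (modnat_hcomp s (modnat_id (modfun_id M)) : @chom (mod_hom M N) _ _)
    = s \v @cidto (mod_hom M N) _ _ (mod_comp1r F).
Proof.
apply: modnat_ext => X; rewrite [LHS]/= [RHS]/=.
rewrite (@cidto_mod _ _ _ _ (mod_comp1r F') X erefl).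
rewrite (@cidto_mod _ _ _ _ (mod_comp1r F) X erefl) /=.
by rewrite fmor_id !lcomp1r lcomp1l.
Qed.

Definition CMod : TwoCat :=
  @MkTwoCat (ModCat C) mod_hom modfun_id modfun_comp modnat_hcomp
    mod_hcomp_id mod_hcomp_comp mod_comp1A mod_comp1l mod_comp1r
    mod_hcompA mod_hcomp1l mod_hcomp1r.

End CMod.

(* [TambMor (tamb_unit C) R] is [R 1 1], by evaluation at the identity. *)
Section TambElt.
Variables (k : fieldType) (C : StrictMonCat k) (R : Tamb C).

Lemma tensm1E (F F' : C) (f : lhom F F') :
  tensm f (lid (sunit C)) = idto (esym (tenso1 F')) \c f \c idto (tenso1 F).
Proof. by rewrite -lcompA -tensm1 lcompA idtoK lcomp1l. Qed.

Lemma tensm_1idto (H F F' : C) (e : F = F') (e' : tens H F = tens H F') :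
  tensm (lid H) (idto e) = idto e'.
Proof. exact: (tensm_idto (erefl H) e e'). Qed.

Section Elt.
Variable r : R (sunit C) (sunit C).

Let elt (F G : C) (f : tamb_unit C F G) : R F G :=
  tmap (idto (esym (tenso1 F))) ((f : lhom F G) \c idto (tenso1 F)) (tstr F r).

Lemma tamb_elt_lin F G : linear (@elt F G).
Proof. by move=> a u v; rewrite /elt lcomp_linl tmap_linr. Qed.

Lemma tamb_elt_nat F F' G G' (f : lhom F' F) (g : lhom G G')
  (x : tamb_unit C F G) : elt (tmap f g x) = tmap f g (elt x).
Proof.
rewrite /elt -tmap_comp /=.
have -> : idto (esym (tenso1 F)) \c f
    = tensm f (lid (sunit C)) \c idto (esym (tenso1 F')).
  by rewrite tensm1E idtoKr.
rewrite -[g \c (_ \c _)]lcomp1r [RHS]tmap_comp -tstr_dinat -tmap_comp lcomp1l.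
by rewrite tensm1E !lcompA idtoKr.
Qed.

Lemma tamb_elt_str H F G (x : tamb_unit C F G) :
  elt (tstr H x) = tstr H (elt x).
Proof.
rewrite /elt tstr_nat tstr_tens -tmap_comp /=.
have -> : tensm (lid H) ((x : lhom F G) \c idto (tenso1 F))
    = tensm (lid H) (x : lhom F G) \c tensm (lid H) (idto (tenso1 F)).
  by rewrite -tensm_comp lcomp1l.
rewrite (tensm_1idto _ (congr1 (tens H) (esym (tenso1 F)))).
rewrite (tensm_1idto _ (congr1 (tens H) (tenso1 F))).
rewrite -lcompA !idto_comp (idto_irr (etrans (esym _) _)
  (congr1 (tens H) (esym (tenso1 F)))).
by rewrite (idto_irr (etrans _ (tenso1 _)) (congr1 (tens H) (tenso1 F))).
Qed.

Definition tamb_elt : TambMor (tamb_unit C) R :=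
  MkTambMor tamb_elt_lin tamb_elt_nat tamb_elt_str.

Lemma tamb_eltE : tamb_elt _ _ (lid (sunit C)) = r.
Proof.
rewrite /= /elt tstr_one -tmap_comp lcomp1l !idto_comp.
by rewrite !idto1 tmap_id.
Qed.

End Elt.

Lemma tamb_eltK (s : TambMor (tamb_unit C) R) :
  tamb_elt (s _ _ (lid (sunit C))) = s.
Proof.
apply: tambmor_ext => F G f /=.
rewrite -tmor_str -tmor_nat /= tensm_id lcomp1r.
by rewrite idtoKr.
Qed.

End TambElt.

Lemma conj_irr (k : fieldType) (A : LinCat k) (W X Y Z : A) (a a' : Y = Z)
  (b b' : W = X) (u : lhom X Y) :
  idto a \c (u \c idto b) = idto a' \c (u \c idto b').
Proof. by rewrite (idto_irr a a') (idto_irr b b'). Qed.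

Section SDef.
Variables (k : fieldType) (C : StrictMonCat k).

Section Objects.
Variable M : ModCat C.

Lemma act1_conj (X Y : M) (u : lhom X Y) :
  fmor (act M (sunit C)) u = idto (esym (act1E Y)) \c u \c idto (act1E X).
Proof. by rewrite -lcompA -act1_mor lcompA idtoK lcomp1l. Qed.

Lemma actT_conj (F G : C) (X Y : M) (u : lhom X Y) :
  fmor (act M (tens F G)) u
    = idto (esym (actTE F G Y)) \c fmor (act M F) (fmor (act M G) u)
        \c idto (actTE F G X).
Proof. by rewrite -lcompA -actT_mor lcompA idtoK lcomp1l. Qed.

Lemma actm_tens_conj (F F' G G' : C) (f : lhom F F') (g : lhom G G') (X : M) :
  actm M (tensm f g) X
    = idto (esym (actTE F' G' X))
        \c (actm M f (act M G' X) \c fmor (act M F) (actm M g X))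
        \c idto (actTE F G X).
Proof. by rewrite -[RHS]lcompA -actm_tens lcompA idtoK lcomp1l. Qed.

Section HomObject.
Variables X Y : M.

Let sob (F G : C) : lmodType k := lhom (act M F X) (act M G Y).

Let smap (F F' G G' : C) (f : lhom F' F) (g : lhom G G') (u : sob F G) :
  sob F' G' := actm M g Y \c u \c actm M f X.

Let sstr (H F G : C) (u : sob F G) : sob (tens H F) (tens H G) :=
  idto (esym (actTE H G Y)) \c fmor (act M H) u \c idto (actTE H F X).

Lemma S_hom_subproof1 F F' G G' (f : lhom F' F) (g : lhom G G') :
  linear (smap f g).
Proof. by move=> a u v; rewrite /smap lcomp_linr lcomp_linl. Qed.

Lemma S_hom_subproof2 F F' G G' (g : lhom G G') (u : sob F G) :
  linear (fun f : lhom F' F => smap f g u).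
Proof. by move=> a f f'; rewrite /smap actm_lin lcomp_linr. Qed.

Lemma S_hom_subproof3 F F' G G' (f : lhom F' F) (u : sob F G) :
  linear (fun g : lhom G G' => smap f g u).
Proof. by move=> a g g'; rewrite /smap actm_lin !lcomp_linl. Qed.

Lemma S_hom_subproof4 F G (u : sob F G) : smap (lid F) (lid G) u = u.
Proof. by rewrite /smap !actm_id lcomp1l lcomp1r. Qed.

Lemma S_hom_subproof5 F F' F'' G G' G'' (f' : lhom F'' F')
  (f : lhom F' F) (g' : lhom G' G'') (g : lhom G G') (u : sob F G) :
  smap (f \c f') (g' \c g) u = smap f' g' (smap f g u).
Proof. by rewrite /smap !actm_comp !lcompA. Qed.

Lemma S_hom_subproof6 H F G : linear (@sstr H F G).
Proof. by move=> a u v; rewrite /sstr fmor_lin lcomp_linr lcomp_linl. Qed.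

Lemma S_hom_subproof7 H F F' G G' (f : lhom F' F) (g : lhom G G')
  (u : sob F G) :
  sstr H (smap f g u) = smap (tensm (lid H) f) (tensm (lid H) g) (sstr H u).
Proof.
rewrite /sstr /smap !actm_tens_conj !actm_id !lcomp1l !fmor_comp !lcompA.
by rewrite !idtoKr.
Qed.

Lemma S_hom_subproof8 H K (h : lhom H K) F G (u : sob F G) :
  smap (lid (tens H F)) (tensm h (lid G)) (sstr H u)
    = smap (tensm h (lid F)) (lid (tens K G)) (sstr K u).
Proof.
rewrite /sstr /smap !actm_tens_conj !actm_id lcomp1l lcomp1r !fmor_id.
rewrite !lcomp1r !lcompA !idtoKr.
by rewrite -[_ \c actm M h _ \c _]lcompA nnat lcompA.
Qed.

Lemma S_hom_subproof9 F G (u : sob F G) :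
  sstr (sunit C) u = smap (idto (tens1o F)) (idto (esym (tens1o G))) u.
Proof.
rewrite /sstr /smap act1_conj.
rewrite (actm_idto (tens1o F) (congr1 (fun A => act M A X) (tens1o F))).
rewrite (actm_idto (esym (tens1o G))
  (congr1 (fun A => act M A Y) (esym (tens1o G)))).
rewrite !lcompA -[_ \c idto _ \c idto _]lcompA !idto_comp.
by congr (_ \c _ \c _); apply: idto_irr.
Qed.

Lemma S_hom_subproof10 K H F G (u : sob F G) :
  sstr (tens K H) u
    = smap (idto (esym (tensA K H F))) (idto (tensA K H G))
        (sstr K (sstr H u)).
Proof.
rewrite /sstr /smap actT_conj !fmor_comp.
rewrite (actm_idto _ (congr1 (fun A => act M A X) (esym (tensA K H F)))).
rewrite (actm_idto _ (congr1 (fun A => act M A Y) (tensA K H G))).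
rewrite (fmor_idto _ (congr1 (act M K) (esym (actTE H G Y)))).
rewrite (fmor_idto _ (congr1 (act M K) (actTE H F X))).
rewrite !lcompA !idto_comp -!lcompA !idto_comp.
exact: conj_irr.
Qed.

Definition S_hom : Tamb C :=
  MkTamb S_hom_subproof1 S_hom_subproof2 S_hom_subproof3 S_hom_subproof4
    S_hom_subproof5 S_hom_subproof6 S_hom_subproof7 S_hom_subproof8
    S_hom_subproof9 S_hom_subproof10.

End HomObject.

Lemma S_comp_bal (X Y Z : M) :
  tbalanced (P := S_hom X Y) (Q := S_hom Y Z) (R := S_hom X Z)
    (fun F G H (f : lhom (act M F X) (act M H Y))
       (g : lhom (act M H Y) (act M G Z)) => g \c f).
Proof.
split=> [F G|F F' G G' f g H x y|H F G K x y] /=.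
- split=> [H g|H f|H H' h x y] /=.
  + exact: lcomp_linr.
  + exact: lcomp_linl.
  + by rewrite !actm_id lcomp1r lcomp1l lcompA.
- by rewrite !actm_id lcomp1r lcomp1l !lcompA.
- by rewrite !lcompA idtoKr fmor_comp !lcompA.
Qed.

Definition S_comp (X Y Z : M) :
  TambMor (tamb_tens (S_hom X Y) (S_hom Y Z)) (S_hom X Z) :=
  tamb_lift (@S_comp_bal X Y Z).

Lemma S_compE (X Y Z : M) F G H (f : S_hom X Y F H) (g : S_hom Y Z H G) :
  S_comp X Y Z F G (tgen f g) = (g : lhom (act M H Y) (act M G Z)) \c f.
Proof. exact: (tamb_liftE (@S_comp_bal X Y Z)). Qed.

Section UnitElt.
Variable X : M.

Let e (F G : C) (f : tamb_unit C F G) : S_hom X X F G := actm M f X.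

Lemma S_id_lin F G : linear (@e F G).
Proof. exact: actm_lin. Qed.

Lemma S_id_nat F F' G G' (f : lhom F' F) (g : lhom G G')
  (x : tamb_unit C F G) : e (tmap f g x) = tmap f g (e x).
Proof. by rewrite /e /= !actm_comp. Qed.

Lemma S_id_str H F G (x : tamb_unit C F G) : e (tstr H x) = tstr H (e x).
Proof. by rewrite /e /= actm_tens_conj actm_id lcomp1l. Qed.

Definition S_id : TambMor (tamb_unit C) (S_hom X X) :=
  MkTambMor S_id_lin S_id_nat S_id_str.

End UnitElt.

Lemma S_assoc (W X Y Z : M) :
  tambmor_comp (S_comp W X Z)
      (tamb_tensm (tambmor_id (S_hom W X)) (S_comp X Y Z))
    = tambmor_comp
        (tambmor_comp (S_comp W Y Z)
          (tamb_tensm (S_comp W X Y) (tambmor_id (S_hom Y Z))))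
        (tamb_assocV (S_hom W X) (S_hom X Y) (S_hom Y Z)).
Proof.
apply: tambmor_ext => F G; apply: tens_ext3'; [exact: tmor_lin..|].
by move=> H K x y z; rewrite !(tensE, S_compE) lcompA.
Qed.

Lemma S_unitl (X Y : M) :
  tambmor_comp (S_comp X Y Y) (tamb_tensm (tambmor_id (S_hom X Y)) (S_id Y))
    = tamb_rho (S_hom X Y).
Proof.
apply: tambmor_tens_ext => F G H x f; rewrite !(tensE, S_compE) /=.
by rewrite actm_id lcomp1r.
Qed.

Lemma S_unitr (X Y : M) :
  tambmor_comp (S_comp X X Y) (tamb_tensm (S_id X) (tambmor_id (S_hom X Y)))
    = tamb_lam (S_hom X Y).
Proof.
apply: tambmor_tens_ext => F G H f x; rewrite !(tensE, S_compE) /=.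
by rewrite actm_id lcomp1l.
Qed.

Definition S_ob : EnrCat (mon_rev (TambMon C)) :=
  @MkEnrCat (mon_rev (TambMon C)) M S_hom S_id S_comp S_assoc S_unitl S_unitr.

End Objects.

Section OneCells.
Variables (M N : ModCat C) (Phi : ModFun M N).

Section OnHom.
Variables X Y : M.

Let m (F G : C) (u : S_hom X Y F G) : S_hom (Phi X) (Phi Y) F G :=
  mphiV Phi G Y \c fmor Phi (u : lhom (act M F X) (act M G Y)) \c mphi Phi F X.

Lemma S_mor_lin F G : linear (@m F G).
Proof. by move=> a u v; rewrite /m fmor_lin lcomp_linr lcomp_linl. Qed.

Lemma S_mor_nat F F' G G' (f : lhom F' F) (g : lhom G G')
  (u : S_hom X Y F G) : m (tmap f g u) = tmap f g (m u).
Proof.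
rewrite /m /= !fmor_comp !lcompA mphiV_natl -!lcompA; congr (_ \c _).
by rewrite mphi_natl.
Qed.

Lemma S_mor_str H F G (u : S_hom X Y F G) : m (tstr H u) = tstr H (m u).
Proof.
have phiE : mphi Phi (tens H F) X
    = fmor Phi (idto (esym (actTE H F X)))
      \c (mphi Phi H (act M F X) \c fmor (act N H) (mphi Phi F X)
          \c idto (actTE H F (Phi X))).
  by rewrite -mphi_tens lcompA -fmor_comp idtoK fmor_id lcomp1l.
have phiVE : mphiV Phi (tens H G) Y
    = idto (esym (actTE H G (Phi Y)))
      \c fmor (act N H) (mphiV Phi G Y) \c mphiV Phi H (act M G Y)
      \c fmor Phi (idto (actTE H G Y)).
  rewrite -[RHS]lcomp1r -(mphiVK Phi (tens H G) Y) [RHS]lcompA.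
  rewrite -[_ \c fmor Phi _ \c mphi _ _ _]lcompA mphi_tens !lcompA.
  rewrite -[_ \c mphiV Phi H _ \c mphi Phi H _]lcompA mphiK lcomp1r.
  rewrite -[_ \c fmor _ (mphiV _ _ _) \c _]lcompA -fmor_comp mphiK fmor_id.
  by rewrite lcomp1r idtoK lcomp1l.
rewrite /m /= phiE phiVE !fmor_comp !lcompA.
rewrite -[_ \c fmor Phi (idto (actTE H G Y)) \c _]lcompA -fmor_comp idtoK.
rewrite fmor_id lcomp1r.
rewrite -[_ \c fmor Phi (idto _) \c fmor Phi (idto _)]lcompA -fmor_comp idtoK.
rewrite fmor_id lcomp1r -[_ \c mphiV Phi H _ \c _]lcompA mphiV_nat.
by rewrite !lcompA -[_ \c mphiV Phi H _ \c _]lcompA mphiK lcomp1r.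
Qed.

Definition S_mor : TambMor (S_hom X Y) (S_hom (Phi X) (Phi Y)) :=
  MkTambMor S_mor_lin S_mor_nat S_mor_str.

Lemma S_morE F G (u : S_hom X Y F G) :
  S_mor F G u
    = mphiV Phi G Y \c fmor Phi (u : lhom (act M F X) (act M G Y))
        \c mphi Phi F X.
Proof. by []. Qed.

End OnHom.

Lemma S_mor_id (X : M) :
  tambmor_comp (S_mor X X) (S_id X) = S_id (Phi X).
Proof.
apply: tambmor_ext => F G f; rewrite tensE S_morE /= mphiV_natl -lcompA.
by rewrite mphiK lcomp1r.
Qed.

Lemma S_mor_comp (X Y Z : M) :
  tambmor_comp (S_mor X Z) (S_comp X Y Z)
    = tambmor_comp (S_comp (Phi X) (Phi Y) (Phi Z))
        (tamb_tensm (S_mor X Y) (S_mor Y Z)).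
Proof.
apply: tambmor_tens_ext => F G H x y.
rewrite !(tensE, S_compE) !S_morE fmor_comp !lcompA.
by rewrite -[_ \c mphi Phi H Y \c _]lcompA mphiVK lcomp1r.
Qed.

Definition S_fun : EnrFun (S_ob M) (S_ob N) :=
  @MkEnrFun (mon_rev (TambMon C)) (S_ob M) (S_ob N) Phi S_mor S_mor_id
    S_mor_comp.

End OneCells.

Section TwoCells.
Variables (M N : ModCat C) (Phi Phi' : ModFun M N) (t : ModNat Phi Phi').

Lemma mnat_phiV (F : C) (X : M) :
  fmor (act N F) (mnat t X) \c mphiV Phi F X
    = mphiV Phi' F X \c mnat t (act M F X).
Proof.
rewrite -[RHS]lcomp1r -(mphiVK Phi F X) [RHS]lcompA.
rewrite -[_ \c mphi Phi F X]lcompA mnat_phi [_ \c (mphi Phi' F X \c _)]lcompA.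
by rewrite mphiK lcomp1l.
Qed.

(* [t_X], seen in [[Phi X, Phi' X](1, 1)] through [N1 = Id]. *)
Definition S_elt (X : M) : S_hom (Phi X) (Phi' X) (sunit C) (sunit C) :=
  idto (esym (act1E (Phi' X))) \c mnat t X \c idto (act1E (Phi X)).

Definition S_cmp (X : M) : TambMor (tamb_unit C) (S_hom (Phi X) (Phi' X)) :=
  tamb_elt (S_elt X).

Lemma S_cmpE (X : M) (F G : C) (f : lhom F G) :
  S_cmp X F G f = actm N f (Phi' X) \c fmor (act N F) (mnat t X).
Proof.
rewrite /= /S_elt !fmor_comp actm_comp.
rewrite (actm_idto _ (congr1 (fun A => act N A (Phi' X)) (tenso1 F))).
rewrite (actm_idto _ (congr1 (fun A => act N A (Phi X)) (esym (tenso1 F)))).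
rewrite (fmor_idto _ (congr1 (act N F) (act1E (Phi X)))).
rewrite (fmor_idto _ (congr1 (act N F) (esym (act1E (Phi' X))))).
rewrite -!lcompA !idto_comp; congr (_ \c _).
by rewrite !lcompA !idto_comp !idto1 lcomp1l lcomp1r.
Qed.

Lemma S_cmp_nat (X Y : M) :
  tambmor_comp
      (tambmor_comp (S_comp (Phi X) (Phi Y) (Phi' Y))
        (tamb_tensm (S_mor Phi X Y) (S_cmp Y)))
      (tamb_rhoV (S_hom X Y))
    = tambmor_comp
      (tambmor_comp (S_comp (Phi X) (Phi' X) (Phi' Y))
        (tamb_tensm (S_cmp X) (S_mor Phi' X Y)))
      (tamb_lamV (S_hom X Y)).
Proof.
apply: tambmor_ext => F G u.
rewrite !(tensE, S_compE) !S_cmpE !S_morE !actm_id !lcomp1l.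
rewrite -[RHS]lcompA -mnat_phi !lcompA mnat_phiV; congr (_ \c _).
by rewrite -!lcompA nnat.
Qed.

Definition S_nat : EnrNat (S_fun Phi) (S_fun Phi') :=
  @MkEnrNat (mon_rev (TambMon C)) (S_ob M) (S_ob N) (S_fun Phi) (S_fun Phi')
    S_cmp S_cmp_nat.

End TwoCells.

Definition S_data : TwoFunData (CMod C) (EnrTwoCat (mon_rev (TambMon C))) :=
  @MkTwoFunData (CMod C) (EnrTwoCat (mon_rev (TambMon C)))
    S_ob S_fun S_nat.

End SDef.

(* Main.v *)
Require Import Defs.
From mathcomp Require Import all_boot all_algebra.
From mathcomp Require Import boolp.

Set Implicit Arguments.
Unset Strict Implicit.
Unset Printing Implicit Defensive.

Local Open Scope ring_scope.
Local Open Scope lin_scope.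
Local Open Scope cat_scope.

(** The hom-object [X, Y] of [S M] remembers every morphism [MF X -> MG Y], and
    in particular, at [F = G = 1], the morphisms [X -> Y] of [M] itself; its
    other values let the action be expressed by composition alone.

    On 2-cells: a transformation of enriched functors has components in
    [Tamb(C(-,-), [Phi X, Phi' X])], which by evaluation at [id_1] is
    [Hom_N(Phi X, Phi' X)].  Write [name v] for the Tambara morphism
    corresponding to [v] ([nameK], [unnameK]).  Since [S] replaces a morphism by
    its name and the enriched composite of names is the name of the composite
    ([S_emul_name]), functoriality of [S] on 2-cells is formal.  Enriched
    naturality of a family of names, tested on an arbitrary [MF X -> Y] at
    [(F, 1)], is a single equation that contains both the naturality of the
    family and its compatibility with the coherence isomorphisms
    ([unname_mphi_nat]).  Hence [S] is bijective on 2-cells.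

    On 1-cells: an enriched functor [T] is a family of maps on the spaces
    [Hom(MF X, MG Y)] that preserves composition and the Tambara structure.
    At [F = G = 1] it gives the action of a functor [Phi] on morphisms.  The
    identity of [MF X] is an element of both [[X, MF X](F, 1)] and
    [[MF X, X](1, F)], and these two elements are mutually inverse under
    composition; their images under [T] are [phi_F] and its inverse.  Every
    [u : MF X -> MG Y] factors as the second kind of identity after [u], seen at
    [(1, 1)], after the first kind, so that
    [T u = phi_G^-1 . Phi u . phi_F] ([phiV_mor_phi_of_enr]); this says that
    [S Phi = T] on the nose.  The axioms of a module functor for [Phi]
    reduce to the functoriality of [T], with the Tambara structure entering
    through [act_hmor1]: that lemma computes the action of [N] on values of [T],
    hence gives [NF (Phi u) = T (MF u)], which is the naturality of [phi_F], and
    the value of [NF phi_G], which is the tensor coherence.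

    So each functor between hom-categories is fully faithful and strictly
    surjective on objects, and it is an equivalence by the axiom of choice
    ([surj_ff_equivalence]). *)

(** * Fully faithful functors that are surjective on objects *)

Definition fully_faithful (D E : Cat) (F : Functor D E) : Prop :=
  forall (X Y : D) (f : chom (F X) (F Y)),
    exists2 g : chom X Y, ctmor F g = f & forall g', ctmor F g' = f -> g' = g.

Section SurjectiveEquivalence.
Variables (D E : Cat) (F : Functor D E).
Hypothesis F_ff : fully_faithful F.
Hypothesis F_surj : forall Y : E, exists X : D, F X = Y.

Lemma ff_inj (X Y : D) (f g : chom X Y) : ctmor F f = ctmor F g -> f = g.
Proof.
move=> fg; have [h _ h_uniq] := F_ff (ctmor F g).
exact: etrans (h_uniq f fg) (esym (h_uniq g erefl)).
Qed.

Let sec (Y : E) : D := sval (cid (F_surj Y)).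
Let secK (Y : E) : F (sec Y) = Y := svalP (cid (F_surj Y)).

Let lift (X Y : D) (f : chom (F X) (F Y)) : chom X Y :=
  s2val (cid2 (F_ff f)).

Let liftK (X Y : D) (f : chom (F X) (F Y)) : ctmor F (lift f) = f.
Proof. by rewrite /lift; case: cid2. Qed.

Let secm (Y Y' : E) (f : chom Y Y') : chom (sec Y) (sec Y') :=
  lift (cidto (esym (secK Y')) \v f \v cidto (secK Y)).

Let secm_id (Y : E) : secm (catid Y) = catid (sec Y).
Proof.
apply: ff_inj; rewrite liftK ctmor_id ccomp1r.
by case: (cidtoK (secK Y)).
Qed.

Let secm_comp (Y Y' Y'' : E) (g : chom Y' Y'') (f : chom Y Y') :
  secm (g \v f) = secm g \v secm f.
Proof.
apply: ff_inj; rewrite ctmor_comp !liftK !ccompA; congr (_ \v _ \v _).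
by rewrite -[_ \v cidto _ \v _]ccompA (cidtoK (secK Y')).1 ccomp1r.
Qed.

Lemma surj_ff_equivalence : cat_equivalence F.
Proof.
pose G := MkFunctor secm_id secm_comp; exists G; split; constructor.
  pose a X := lift (cidto (secK (F X))).
  pose b X := lift (cidto (esym (secK (F X)))).
  apply: (@MkNatIso D D (functor_comp G F) (functor_id D) a b)
    => [X|X|X Y f]; apply: ff_inj; rewrite !ctmor_comp /= ?ctmor_id !liftK.
  - by case: (cidtoK (secK (F X))).
  - by case: (cidtoK (secK (F X))).
  by rewrite !ccompA (cidtoK (secK (F Y))).1 ccomp1l.
apply: (@MkNatIso E E (functor_comp F G) (functor_id E)
  (fun Y => cidto (secK Y))
  (fun Y => cidto (esym (secK Y)))) => [Y|Y|Y Y' f] /=.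
- by case: (cidtoK (secK Y)).
- by case: (cidtoK (secK Y)).
by rewrite liftK !ccompA (cidtoK (secK Y')).1 ccomp1l.
Qed.

End SurjectiveEquivalence.

(** * Names of morphisms *)

Section Names.
Variables (k : fieldType) (C : StrictMonCat k) (M : ModCat C) (X Y : M).

(** The Tambara morphism [C(-,-) -> [X, Y]] that takes [id_1] to [v], read through
    [M1 = Id]. *)
Definition name (v : lhom X Y) : TambMor (tamb_unit C) (S_hom X Y) :=
  tamb_elt (R := S_hom X Y) (idto (esym (act1E Y)) \c v \c idto (act1E X)).

Definition unname (s : TambMor (tamb_unit C) (S_hom X Y)) : lhom X Y :=
  idto (act1E Y) \c (s _ _ (lid (sunit C)) : lhom (act M _ X) (act M _ Y))
    \c idto (esym (act1E X)).

(** A Tambara morphism out of [C(-,-)] takes [f] to the image of [id_1], acted on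
    by [F] and then composed with [f]. *)
Lemma nameE (v : lhom X Y) (F G : C) (f : lhom F G) :
  name v F G f = actm M f Y \c fmor (act M F) v.
Proof.
rewrite /= !fmor_comp actm_comp.
rewrite (actm_idto _ (congr1 (fun A => act M A Y) (tenso1 F))).
rewrite (actm_idto _ (congr1 (fun A => act M A X) (esym (tenso1 F)))).
rewrite (fmor_idto _ (congr1 (act M F) (act1E X))).
rewrite (fmor_idto _ (congr1 (act M F) (esym (act1E Y)))).
rewrite -!lcompA !idto_comp; congr (_ \c _).
by rewrite !lcompA !idto_comp !idto1 lcomp1l lcomp1r.
Qed.

Lemma nameK : cancel name unname.
Proof.
move=> v; rewrite /unname /name tamb_eltE !lcompA idtoK lcomp1l.
by rewrite -lcompA idtoK lcomp1r.
Qed.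

Lemma unnameK : cancel unname name.
Proof.
move=> s; rewrite /unname /name !lcompA idtoK lcomp1l -lcompA idtoK lcomp1r.
exact: tamb_eltK.
Qed.

End Names.

(** * Strict functoriality of [S] *)

Section TwoFunctoriality.
Variables (k : fieldType) (C : StrictMonCat k).
Implicit Types M N P : ModCat C.

Lemma S_emulE M (X Y Z : S_ob M) (b : TambMor (tamb_unit C) (S_hom Y Z))
  (a : TambMor (tamb_unit C) (S_hom X Y)) (F G : C) (f : lhom F G) :
  (@emul _ (S_ob M) X Y Z b a : TambMor _ _) F G f
    = (b G G (lid G) : lhom (act M G Y) (act M G Z)) \c a F G f.
Proof. by rewrite /emul !(tensE, S_compE). Qed.

(** Naming turns the operations on enriched 2-cells into those of [M]; this lemma,
    [S_id_name] and [S_mor_name] are all that the functoriality of [S] on 2-cells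
    uses. *)
Lemma S_emul_name M (X Y Z : M) (b : lhom Y Z) (a : lhom X Y) :
  @emul _ (S_ob M) X Y Z (name b) (name a) = name (b \c a).
Proof.
apply: tambmor_ext => F G f; rewrite S_emulE !nameE actm_id lcomp1l.
by rewrite fmor_comp !lcompA nnat.
Qed.

Lemma S_id_name M (X : M) : S_id X = name (lid X).
Proof.
by apply: tambmor_ext => F G f; rewrite nameE fmor_id lcomp1r.
Qed.

Lemma S_mor_name M N (Phi : ModFun M N) (X Y : M) (v : lhom X Y) :
  tambmor_comp (S_mor Phi X Y) (name v) = name (fmor Phi v).
Proof.
apply: tambmor_ext => F G f; rewrite tensE S_morE !nameE (fmor_comp Phi) lcompA.
rewrite mphiV_natl -[_ \c mphiV _ _ _ \c _]lcompA mphiV_nat lcompA.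
by rewrite -lcompA mphiK lcomp1r.
Qed.

Lemma S_fun_id M : S_fun (modfun_id M) = enrfun_id (S_ob M).
Proof.
apply: enrfun_ext => X Y; apply: tambmor_ext => F G u.
by rewrite S_morE /= lcomp1l lcomp1r.
Qed.

Lemma S_fun_comp M N P (Psi : ModFun N P) (Phi : ModFun M N) :
  S_fun (modfun_comp Psi Phi) = enrfun_comp (S_fun Psi) (S_fun Phi).
Proof.
apply: enrfun_ext => X Y; apply: tambmor_ext => F G u.
by rewrite tensE !S_morE /= !(fmor_comp Psi) !lcompA.
Qed.

Lemma S_nat_id M N (Phi : ModFun M N) :
  S_nat (modnat_id Phi) = enat_id (S_fun Phi).
Proof. by apply: enat_ext => X; apply: esym; apply: S_id_name. Qed.

Lemma S_nat_comp M N (Phi Phi' Phi'' : ModFun M N) (b : ModNat Phi' Phi'')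
  (a : ModNat Phi Phi') :
  S_nat (modnat_comp b a) = enat_comp (S_nat b) (S_nat a).
Proof. by apply: enat_ext => X; apply: esym; apply: S_emul_name. Qed.

Lemma S_nat_hcomp M N P (Psi Psi' : ModFun N P) (Phi Phi' : ModFun M N)
  (b : ModNat Psi Psi') (a : ModNat Phi Phi') (X : M) :
  S_nat (modnat_hcomp b a) X = enat_hcomp (S_nat b) (S_nat a) X.
Proof.
apply: esym.
transitivity (@emul _ (S_ob P) (Psi (Phi X)) (Psi (Phi' X)) (Psi' (Phi' X))
  (name (mnat b (Phi' X))) (name (fmor Psi (mnat a X)))).
  by rewrite -S_mor_name.
exact: S_emul_name.
Qed.

Lemma S_two_functor : is_two_functor (S_data C).
Proof.
apply: (@IsTwoFunctor _ _ (S_data C) S_nat_id _ S_fun_id S_fun_comp).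
  by move=> M N Phi Phi' Phi'' b a; apply: S_nat_comp.
move=> M N P Psi Psi' Phi Phi' b a; apply: enat_ext => X.
rewrite [LHS]/= [RHS]/=.
rewrite (@cidto_enr _ _ _ _ _ (S_fun_comp Psi' Phi') X erefl).
rewrite (@cidto_enr _ _ _ _ _ (S_fun_comp Psi Phi) X erefl).
rewrite [eq_rect _ _ _ _ _]/= [in RHS]/= emul1l emul1r.
exact: S_nat_hcomp.
Qed.

End TwoFunctoriality.

(** * Full faithfulness on 2-cells *)

Section CoherenceOne.
Variables (k : fieldType) (C : StrictMonCat k) (M N : ModCat C).
Variable Phi : ModFun M N.

Lemma mphiV_oneE (X : M) :
  mphiV Phi (sunit C) X
    = idto (esym (act1E (Phi X))) \c fmor Phi (idto (act1E X)).
Proof.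
rewrite -[RHS]lcomp1r -(mphiVK Phi (sunit C) X) [RHS]lcompA.
by rewrite -[_ \c mphi _ _ _]lcompA mphi_one idtoK lcomp1l.
Qed.

(** At [G = 1] the inverse coherence isomorphism in [S Phi] is an identity, so
    that [phi_F] can be read off from [S Phi]. *)
Lemma S_mor_one (F : C) (X Y : M) (u : lhom (act M F X) Y) :
  S_mor Phi X Y F (sunit C) (idto (esym (act1E Y)) \c u)
    = idto (esym (act1E (Phi Y))) \c fmor Phi u \c mphi Phi F X.
Proof.
rewrite S_morE mphiV_oneE -[_ \c fmor Phi _ \c fmor Phi _]lcompA -fmor_comp.
by rewrite idtoKl.
Qed.

End CoherenceOne.

Section FullyFaithful.
Variables (k : fieldType) (C : StrictMonCat k) (M N : ModCat C).
Variables (Phi Phi' : ModFun M N).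

(** Enriched naturality in terms of elements: whiskering by a name is composition
    with the image under the action of the morphism named. *)
Lemma S_nat_natural (t : EnrNat (S_fun Phi) (S_fun Phi')) (X Y : M) (F G : C)
  (u : lhom (act M F X) (act M G Y)) :
  fmor (act N G) (unname (t Y)) \c S_mor Phi X Y F G u
    = (S_mor Phi' X Y F G u : lhom (act N F _) (act N G _))
      \c fmor (act N F) (unname (t X)).
Proof.
have /(congr1 (fun s : TambMor (S_hom X Y) (S_hom (Phi X) (Phi' Y)) =>
  s F G u)) := ecmp_nat t X Y.
rewrite -[ecmp t X]unnameK -[ecmp t Y]unnameK !nameK.
by rewrite !(tensE, S_compE) !nameE !actm_id !lcomp1l.
Qed.

Section ModNatOfEnr.
Variable t : EnrNat (S_fun Phi) (S_fun Phi').
Let v X : lhom (Phi X) (Phi' X) := unname (t X).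

(** Taking [u = id] gives compatibility with [phi]; taking [F = 1], where [phi_1]
    is trivial, gives naturality. *)
Lemma unname_mphi_nat (F : C) (X Y : M) (u : lhom (act M F X) Y) :
  v Y \c fmor Phi u \c mphi Phi F X
    = fmor Phi' u \c mphi Phi' F X \c fmor (act N F) (v X).
Proof.
have /(congr1 (fun w => idto (act1E (Phi' Y)) \c w)) :=
  S_nat_natural t (idto (esym (act1E Y)) \c u : lhom _ (act M (sunit C) Y)).
by rewrite !S_mor_one -/(v _) act1_conj !lcompA !idtoK !lcomp1l idtoKr.
Qed.

Lemma unname_phi (F : C) (X : M) :
  v (act M F X) \c mphi Phi F X = mphi Phi' F X \c fmor (act N F) (v X).
Proof.
by have := unname_mphi_nat (lid (act M F X)); rewrite !fmor_id lcomp1r lcomp1l.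
Qed.

Lemma unname_nat (X Y : M) (u : lhom X Y) :
  v Y \c fmor Phi u = fmor Phi' u \c v X.
Proof.
have phi1 (Psi : ModFun M N) : fmor Psi (u \c idto (act1E X))
    \c mphi Psi (sunit C) X = fmor Psi u \c idto (act1E (Psi X)).
  by rewrite fmor_comp -lcompA mphi_one.
have := unname_mphi_nat (u \c idto (act1E X)).
rewrite -lcompA !phi1 -[RHS]lcompA act1_mor !lcompA.
by move=> /(congr1 (fun w => w \c idto (esym (act1E _)))); rewrite !idtoKr.
Qed.

Definition modnat_of_enr : ModNat Phi Phi' :=
  @MkModNat k C M N Phi Phi' (@MkLinNat k M N Phi Phi' v unname_nat)
    unname_phi.

Lemma S_modnat_of_enr : S_nat modnat_of_enr = t.
Proof. by apply: enat_ext => X; apply: unnameK. Qed.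

End ModNatOfEnr.

Lemma S_nat_inj : injective (@S_nat k C M N Phi Phi').
Proof.
move=> s t st; apply: modnat_ext => X.
have /(congr1 (fun r : EnrNat (S_fun Phi) (S_fun Phi') =>
  unname (ecmp r X))) := st.
by rewrite [LHS]nameK [RHS]nameK.
Qed.

End FullyFaithful.

(** * The module functor underlying an enriched functor *)

Section ModFunOfEnr.
Variables (k : fieldType) (C : StrictMonCat k) (M N : ModCat C).
Variable T : EnrFun (S_ob M) (S_ob N).

Definition hmor (X Y : M) (F G : C) (u : lhom (act M F X) (act M G Y)) :
    lhom (act N F (T X)) (act N G (T Y)) :=
  (efmor T X Y : TambMor (S_hom X Y) (S_hom (T X) (T Y))) F G u.

Lemma hmor_lin X Y F G : linear (@hmor X Y F G).
Proof.
exact: (tmor_lin (efmor T X Y : TambMor (S_hom X Y) (S_hom (T X) (T Y)))).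
Qed.

Lemma hmor_actm (X : M) (F G : C) (f : lhom F G) :
  hmor (actm M f X) = actm N f (T X).
Proof.
exact: (congr1 (fun s : TambMor (tamb_unit C) (S_hom (T X) (T X)) => s F G f)
  (efmor_id T X)).
Qed.

Lemma hmor_comp (X Y Z : M) (F G H : C) (g : lhom (act M G Y) (act M H Z))
  (f : lhom (act M F X) (act M G Y)) : hmor (g \c f) = hmor g \c hmor f.
Proof.
have /(congr1 (fun s : TambMor (tamb_tens (S_hom X Y) (S_hom Y Z))
  (S_hom (T X) (T Z)) => s F H (tgen (P := S_hom X Y) (Q := S_hom Y Z) f g)))
  := efmor_comp T X Y Z.
by rewrite !(tensE, S_compE).
Qed.

Lemma hmor_id (X : M) (F : C) : hmor (lid (act M F X)) = lid (act N F (T X)).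
Proof. by rewrite -actm_id hmor_actm actm_id. Qed.

Lemma hmor_str (H F G : C) (X Y : M) (u : lhom (act M F X) (act M G Y)) :
  hmor (idto (esym (actTE H G Y)) \c fmor (act M H) u \c idto (actTE H F X))
    = idto (esym (actTE H G (T Y))) \c fmor (act N H) (hmor u)
        \c idto (actTE H F (T X)).
Proof.
exact: (tmor_str (efmor T X Y : TambMor (S_hom X Y) (S_hom (T X) (T Y))) H
  (u : S_hom X Y F G)).
Qed.

(** Since [M1 = Id], the morphism [M1 u] is [u] seen at [(1, 1)]. *)
Definition mor_of_enr (X Y : M) (u : lhom X Y) : lhom (T X) (T Y) :=
  idto (act1E (T Y)) \c hmor (fmor (act M (sunit C)) u)
    \c idto (esym (act1E (T X))).

(** The image under [T] of the identity of [MF X], seen in [[X, MF X](F, 1)]. *)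
Definition phi_of_enr (F : C) (X : M) : lhom (act N F (T X)) (T (act M F X)) :=
  idto (act1E (T (act M F X)))
    \c hmor (idto (esym (act1E (act M F X)))).

(** The image under [T] of the identity of [MF X], seen in [[MF X, X](1, F)]. *)
Definition phiV_of_enr (F : C) (X : M) : lhom (T (act M F X)) (act N F (T X)) :=
  hmor (idto (act1E (act M F X)))
    \c idto (esym (act1E (T (act M F X)))).

Lemma mor_of_enr_lin X Y : linear (@mor_of_enr X Y).
Proof.
by move=> a u v; rewrite /mor_of_enr fmor_lin hmor_lin lcomp_linr lcomp_linl.
Qed.

Lemma mor_of_enr_id (X : M) : mor_of_enr (lid X) = lid (T X).
Proof. by rewrite /mor_of_enr fmor_id hmor_id lcomp1r idtoK. Qed.

Lemma mor_of_enr_comp (X Y Z : M) (g : lhom Y Z) (f : lhom X Y) :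
  mor_of_enr (g \c f) = mor_of_enr g \c mor_of_enr f.
Proof. by rewrite /mor_of_enr fmor_comp hmor_comp !lcompA idtoKr. Qed.

Definition linfun_of_enr : LinFun M N :=
  @MkLinFun k M N (efob T) mor_of_enr mor_of_enr_lin mor_of_enr_id
    mor_of_enr_comp.

(** Multiplying by [phi_F] on the right only moves the source of [u] from
    [(MF X, 1)] back to [(X, F)], because [T] preserves the composite of [u] with
    the identity that defines [phi_F].  The axioms of a module functor become
    equations between values of [T] in this way. *)
Lemma mor_of_enr_phi (F : C) (X Y : M) (u : lhom (act M F X) Y) :
  mor_of_enr u \c phi_of_enr F X
    = idto (act1E (T Y)) \c hmor (idto (esym (act1E Y)) \c u).
Proof.
rewrite /mor_of_enr /phi_of_enr !lcompA idtoKr -lcompA -hmor_comp act1_conj.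
by rewrite -!lcompA idtoK lcomp1r.
Qed.

Lemma phiV_mor_phi_of_enr (F G : C) (X Y : M)
  (u : lhom (act M F X) (act M G Y)) :
  phiV_of_enr G Y \c mor_of_enr u \c phi_of_enr F X = hmor u.
Proof.
by rewrite -lcompA mor_of_enr_phi /phiV_of_enr lcompA idtoKr -hmor_comp idtoKl.
Qed.

Lemma phi_of_enrK (F : C) (X : M) :
  phiV_of_enr F X \c phi_of_enr F X = lid (act N F (T X)).
Proof.
rewrite -(lcomp1r (phiV_of_enr F X)) -mor_of_enr_id phiV_mor_phi_of_enr.
exact: hmor_id.
Qed.

Lemma phi_of_enrVK (F : C) (X : M) :
  phi_of_enr F X \c phiV_of_enr F X = lid (T (act M F X)).
Proof.
rewrite /phi_of_enr /phiV_of_enr lcompA -[_ \c hmor _ \c hmor _]lcompA.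
by rewrite -hmor_comp idtoK hmor_id lcomp1r idtoK.
Qed.

(** An equality [MF X = MG X] that comes from [F = G] is a value of the action on
    morphisms, which [T] preserves; [T] need not take an accidental one to an
    identity. *)
Lemma hmor_idto (F G : C) (X : M) (e : F = G)
  (eM : act M F X = act M G X) (eN : act N F (T X) = act N G (T X)) :
  hmor (idto eM) = idto eN.
Proof. by rewrite -(actm_idto e eM) hmor_actm (actm_idto e eN). Qed.

(** The compatibility of [T] with the Tambara structure, after identifying
    [H (x) 1] with [H] in the target. *)
Lemma act_hmor1 (H F : C) (X Y : M)
  (u : lhom (act M F X) (act M (sunit C) Y)) :
  fmor (act N H) (idto (act1E (T Y)) \c hmor u)
    = hmor (fmor (act M H) (idto (act1E Y) \c u) \c idto (actTE H F X))
        \c idto (esym (actTE H F (T X))).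
Proof.
pose e := congr1 (fun K => act M K Y) (tenso1 H).
pose e' := congr1 (fun K => act N K (T Y)) (tenso1 H).
have -> : fmor (act M H) (idto (act1E Y) \c u) \c idto (actTE H F X)
    = idto e \c (idto (esym (actTE H (sunit C) Y)) \c fmor (act M H) u
        \c idto (actTE H F X)).
  rewrite fmor_comp (fmor_idto _ (congr1 (act M H) (act1E Y))) !lcompA.
  by rewrite idto_comp; congr (_ \c _ \c _); apply: idto_irr.
rewrite hmor_comp hmor_str (hmor_idto (tenso1 H) e e').
rewrite fmor_comp (fmor_idto _ (congr1 (act N H) (act1E (T Y)))) !lcompA.
by rewrite idto_comp idtoKr; congr (_ \c _); apply: idto_irr.
Qed.

Lemma act_mor_of_enr (F : C) (X Y : M) (u : lhom X Y) :
  fmor (act N F) (mor_of_enr u) = hmor (fmor (act M F) u).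
Proof.
pose e := congr1 (fun K => act M K X) (tenso1 F).
pose e' := congr1 (fun K => act N K (T X)) (tenso1 F).
rewrite fmor_comp act_hmor1 act1_mor fmor_comp.
rewrite (fmor_idto _ (congr1 (act M F) (act1E X))).
rewrite -[_ \c idto (actTE _ _ _)]lcompA idto_comp (idto_irr _ e).
rewrite hmor_comp (hmor_idto (tenso1 F) e e').
rewrite (fmor_idto _ (congr1 (act N F) (esym (act1E (T X))))) -!lcompA.
by rewrite !idto_comp idto1 lcomp1r.
Qed.

Lemma phi_of_enr_nat (F : C) (X Y : M) (u : lhom X Y) :
  phi_of_enr F Y \c fmor (act N F) (mor_of_enr u)
    = mor_of_enr (fmor (act M F) u) \c phi_of_enr F X.
Proof. by rewrite mor_of_enr_phi act_mor_of_enr hmor_comp lcompA. Qed.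

Lemma phi_of_enr_natl (F G : C) (f : lhom F G) (X : M) :
  phi_of_enr G X \c actm N f (T X) = mor_of_enr (actm M f X) \c phi_of_enr F X.
Proof. by rewrite mor_of_enr_phi -hmor_actm hmor_comp lcompA. Qed.

Lemma phi_of_enr_one (X : M) :
  mor_of_enr (idto (act1E X)) \c phi_of_enr (sunit C) X = idto (act1E (T X)).
Proof. by rewrite mor_of_enr_phi idtoK hmor_id lcomp1r. Qed.

(** The right side is [T] of the identity of [MF (MG X)] in two steps: acting by
    [F] on the element that defines [phi_G] moves it to [(FG, F)], where it
    composes with the element that defines [phi_F]. *)
Lemma phi_of_enr_tens (F G : C) (X : M) :
  mor_of_enr (idto (actTE F G X)) \c phi_of_enr (tens F G) X
    = phi_of_enr F (act M G X) \c fmor (act N F) (phi_of_enr G X)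
        \c idto (actTE F G (T X)).
Proof.
rewrite mor_of_enr_phi [phi_of_enr G X]/phi_of_enr act_hmor1 idtoK fmor_id.
by rewrite lcomp1l lcompA idtoKr /phi_of_enr -lcompA -hmor_comp.
Qed.

Definition modfun_of_enr : ModFun M N :=
  @MkModFun k C M N linfun_of_enr phi_of_enr phiV_of_enr phi_of_enrK
    phi_of_enrVK phi_of_enr_nat phi_of_enr_natl phi_of_enr_one phi_of_enr_tens.

Lemma S_mor_of_enr (X Y : M) : S_mor modfun_of_enr X Y = efmor T X Y.
Proof.
by apply: tambmor_ext => F G u; rewrite S_morE; apply: phiV_mor_phi_of_enr.
Qed.

End ModFunOfEnr.

Lemma S_fun_surj (k : fieldType) (C : StrictMonCat k) (M N : ModCat C)
  (T : EnrFun (S_ob M) (S_ob N)) : exists Phi, S_fun Phi = T.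
Proof.
exists (modfun_of_enr T); have := S_mor_of_enr T.
by case: T => o m i c e; apply: enrfun_ext.
Qed.

Theorem theorem5 (k : fieldType) (C : StrictMonCat k) :
  exists S : TwoFunctor (CMod C) (EnrTwoCat (mon_rev (TambMon C))),
    tfdata S = S_data C /\ two_equivalence (corestrict S).
Proof.
exists (MkTwoFunctor (S_two_functor C)); split=> //; split=> [[Y] [X eqv]|M N].
  by exists X.
apply: surj_ff_equivalence => [Phi Phi' t|T]; last exact: S_fun_surj.
exists (modnat_of_enr t) => [|s st]; first exact: S_modnat_of_enr.
by apply: S_nat_inj; rewrite S_modnat_of_enr.
Qed.
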